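(* Let $M$ be a structure (with $\mathrm{Th}(M)$ countable), $G(M)$ a group definable in $M$, and $G=G(M^* )$ for a suitably saturated $M^*\succ M$. Let $\mathcal A$ be the algebra of all CL-formulas $F(x)$ on $G$ over $M$ which are stable in $M$, and let $\mathcal S$ be the quotient of $S_G(M)$ by the closed equivalence relation $$p\sim_{\mathcal A}q\iff F(p)=F(q)\text{ for all }F\in\mathcal A,$$ with the induced action of $G(M)$ and with the class of $\mathrm{tp}(e/M)$ as distinguished point. Then: \begin{enumerate} \item[(i)] $(\mathcal S,G(M))$ is the (unique) universal definable weakly almost periodic ambit of $G(M)$. \item[(ii)] $G/G^{00}_M$ is the unique universal minimal definable weakly almost periodic flow of $G(M)$. \end{enumerate}
   Context: $G(M)$ is treated as a discrete group. A $G(M)$-flow is an action of $G(M)$ by homeomorphisms on a compact Hausdorff space; an ambit is a flow with a distinguished point whose orbit is dense; a flow is minimal if every orbit is dense. $S_G(M)$ is the space of complete types over $M$ concentrated on $G$, with the natural left action of $G(M)$. A CL-formula on $G$ over $M$ is a continuous function $F:S_G(M)\to\mathbb R$; for $a\in G$ write $F(a)=F(\mathrm{tp}(a/M))$. $F(x)$ is called stable in $M$ if the formula $\phi(x,y)=F(yx)$ is stable in $M$, i.e. for all $\epsilon>0$ there do not exist $a_i,b_i\in G(M)$ ($i<\omega$) with $|\phi(a_i,b_j)-\phi(a_j,b_i)|\geq\epsilon$ for all $i<j$. A flow $X$ is definable if for every $x\in X$ the map $h:G(M)\to X$, $g\mapsto gx$, is definable: for all disjoint closed $C_1,C_2\subseteq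 X$ there is a definable (in $M$) $Z\subseteq G(M)$ with $h^{-1}(C_1)\subseteq Z$ and $h^{-1}(C_2)\subseteq G(M)\setminus Z$. A flow $X$ is weakly almost periodic (wap) if for every continuous $f:X\to\mathbb R$, every $h\in\mathbb R^X$ in the pointwise closure of $\{x\mapsto f(gx):g\in G(M)\}$ is continuous. Universal definable wap ambit: a definable wap ambit mapping onto every definable wap ambit by a continuous $G(M)$-equivariant surjection preserving distinguished points. Universal minimal definable wap flow: a minimal definable wap flow which maps onto every minimal definable wap flow by a continuous $G(M)$-equivariant surjection. Uniqueness is up to isomorphism of ambits, respectively flows. $G^{00}_M$ is the smallest $M$-type-definable subgroup of $G$ of bounded index; $G/G^{00}_M$ is equipped with the logic topology (closed sets are those whose preimages in $G$ are type-definable), with which it is a compact group, and $G(M)$ acts on it by left multiplication. *)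

(* Defs.v *)
From HB Require Import structures.
From mathcomp Require Import all_boot all_order all_algebra finmap generic_quotient.
From mathcomp Require Import all_classical all_reals all_analysis.
Import Order.TTheory GRing.Theory Num.Theory.
Import numFieldNormedType.Exports.

Set Implicit Arguments.
Unset Strict Implicit.
Unset Printing Implicit Defensive.

Local Open Scope classical_set_scope.

Definition card_lt (T U : Type) (A : set T) (B : set U) : Prop :=
  (A #<= B)%card /\ ~ (B #<= A)%card.

Definition scons (T : Type) n (a : T) (v : 'I_n -> T) : 'I_n.+1 -> T :=
  fun i => if unlift ord0 i is Some k then v k else a.

Definition tcat (T : Type) m n (v : 'I_m -> T) (w : 'I_n -> T) :
    'I_(m + n) -> T :=
  fun i => match fintype.split i with inl k => v k | inr k => w k end.

Lemma scons_tcat (T : Type) m n (a : T) (v : 'I_m -> T) (w : 'I_n -> T) :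
  (scons a (tcat v w) : 'I_(m.+1 + n) -> T) = tcat (scons a v) w.
Proof.
apply/funext => i; rewrite /scons /tcat.
case: unliftP => [k|] ->.
  case: splitP => k' /= kk'; case: splitP => l /= /eqP.
  - rewrite /bump /= add1n kk' => /eqP kl.
    case: unliftP => [l'|] El; last by rewrite El in kl.
    by congr v; apply/val_inj; rewrite El /= /bump /= add1n in kl; case: kl.
  - rewrite /bump /= add1n kk' addSn eqSS => /eqP kl.
    by move: (ltn_ord k'); rewrite kl ltnNge leq_addr.
  - rewrite /bump /= add1n kk' => /eqP kl.
    by move: (ltn_ord l); rewrite -kl ltnS ltnNge leq_addr.
  - rewrite /bump /= add1n kk' addSn eqSS eqn_add2l => /eqP kl.
    by congr w; apply/val_inj.
case: splitP => l /= lE; last by move: lE; rewrite addSn.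
case: unliftP => [l'|] El //.
by rewrite El in lE.
Qed.

Record language := Language {
  fsym : Type; farity : fsym -> nat;
  rsym : Type; rarity : rsym -> nat }.

Record structure (L : language) := Structure {
  dom :> Type;
  dom_inhabited : inhabited dom;
  fint : forall f : fsym L, ('I_(farity f) -> dom) -> dom;
  rint : forall r : rsym L, ('I_(rarity r) -> dom) -> Prop }.

(* [formula A n]: formulas over the language expanded by constants for the
   elements of [A], with free variables among x_0, ..., x_(n-1).  [FEx] binds
   the variable [ord0] of its body. *)
Section Syntax.
Variables (L : language) (A : Type).

Inductive term (n : nat) : Type :=
  | TVar of 'I_n
  | TPar of A
  | TApp (f : fsym L) of ('I_(farity f) -> term n).

Inductive formula : nat -> Type :=
  | FEq n of term n & term n : formula n
  | FRel n (r : rsym L) of ('I_(rarity r) -> term n) : formula n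
  | FNot n of formula n : formula n
  | FAnd n of formula n & formula n : formula n
  | FEx n of formula n.+1 : formula n.

Fixpoint tsubst m n (s : 'I_m -> term n) (t : term m) : term n :=
  match t with
  | TVar i => s i
  | TPar a => TPar n a
  | TApp f args => TApp (fun i => tsubst s (args i))
  end.

Definition up m n (s : 'I_m -> term n) : 'I_m.+1 -> term n.+1 :=
  scons (TVar ord0) (fun k => tsubst (fun i => TVar (lift ord0 i)) (s k)).

Fixpoint subst m (phi : formula m) : forall n, ('I_m -> term n) -> formula n :=
  match phi in formula m return forall n, ('I_m -> term n) -> formula n with
  | FEq _ t u => fun n s => FEq (tsubst s t) (tsubst s u)
  | FRel _ r args => fun n s => FRel (fun i => tsubst s (args i))
  | FNot _ p => fun n s => FNot (subst p s)
  | FAnd _ p q => fun n s => FAnd (subst p s) (subst q s)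
  | FEx _ p => fun n s => FEx (subst p (up s))
  end.

Fixpoint exs k n : formula (k + n) -> formula n :=
  match k return formula (k + n) -> formula n with
  | 0 => id
  | k'.+1 => fun phi : formula (k'.+1 + n) =>
      exs (FEx (phi : formula (k' + n).+1))
  end.

End Syntax.
Arguments TVar {L A n}.
Arguments TPar {L A n}.

Section Semantics.
Variables (L : language) (A : Type) (N : structure L) (par : A -> N).

Fixpoint teval n (v : 'I_n -> N) (t : term L A n) : N :=
  match t with
  | TVar i => v i
  | TPar a => par a
  | TApp f args => fint (fun i => teval v (args i))
  end.

Fixpoint sat n (phi : formula L A n) : ('I_n -> N) -> Prop :=
  match phi in formula _ _ n return ('I_n -> N) -> Prop with
  | FEq _ t u => fun v => teval v t = teval v u
  | FRel _ r args => fun v => rint (fun i => teval v (args i))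
  | FNot _ p => fun v => ~ sat p v
  | FAnd _ p q => fun v => sat p v /\ sat q v
  | FEx _ p => fun v => exists a, sat p (scons a v)
  end.

Definition satisfies n (Phi : set (formula L A n)) (v : 'I_n -> N) : Prop :=
  forall phi, Phi phi -> sat phi v.

Definition finitely_satisfiable n (Phi : set (formula L A n)) : Prop :=
  forall Psi, finite_set Psi -> Psi `<=` Phi -> exists v, satisfies Psi v.

Definition complete_type n (p : set (formula L A n)) : Prop :=
  finitely_satisfiable p /\ forall phi, p phi \/ p (FNot phi).

Lemma teval_subst m n (s : 'I_m -> term L A n) (t : term L A m) v :
  teval v (tsubst s t) = teval (fun i => teval v (s i)) t.
Proof.
by elim: t => //= f args IH; congr fint; apply/funext => i; exact: IH.
Qed.

Lemma teval_up m n (s : 'I_m -> term L A n) a v :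
  (fun i => teval (scons a v) (up s i)) = scons a (fun i => teval v (s i)).
Proof.
apply/funext => i; rewrite /up {2 3}/scons; case: unliftP => [k|] _ /=.
  rewrite teval_subst; congr teval; apply/funext => l /=.
  by rewrite /scons liftK.
by rewrite /scons unlift_none.
Qed.

Lemma sat_subst m (phi : formula L A m) n (s : 'I_m -> term L A n) v :
  sat (subst phi s) v <-> sat phi (fun i => teval v (s i)).
Proof.
elim: phi n s v => /= {m}.
- by move=> m t u n s v; rewrite !teval_subst.
- move=> m r args n s v.
  by under eq_fun do rewrite teval_subst.
- by move=> m p IH n s v; rewrite IH.
- by move=> m p IHp q IHq n s v; rewrite IHp IHq.
- move=> m p IH n s v; split=> -[a pa]; exists a.
    by move/IH: pa; rewrite teval_up.
  by apply/IH; rewrite teval_up.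
Qed.

Lemma sat_exs k n (phi : formula L A (k + n)) v :
  sat (exs phi) v <-> exists w, sat phi (tcat w v).
Proof.
elim: k phi => [|k IH] phi.
  have tE (w : 'I_0 -> N) : tcat w v = v.
    apply/funext => i; rewrite /tcat; case: splitP => [[]//|l il].
    by congr v; exact/val_inj.
  split=> [pv|[w]]; last by rewrite tE.
  by exists (fun i : 'I_0 => match notF (ltn_ord i) with end); rewrite tE.
rewrite /= IH /=; split=> [[w [a pa]]|[w pw]].
  by exists (scons a w); rewrite -scons_tcat.
exists (fun i => w (lift ord0 i)), (w ord0).
rewrite scons_tcat (_ : scons _ _ = w)//; apply/funext => i.
by rewrite /scons; case: unliftP => [l|] ->.
Qed.

End Semantics.

Definition theory (L : language) (M : structure L) :
    set (formula L void 0) :=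
  [set sigma | forall v, sat (of_void M) sigma v].

(* Elementarity is asserted for formulas with constants from M, i.e. M and N
   are models of the same elementary diagram. *)
Record elementary_extension (L : language) (M : structure L) :=
  ElementaryExtension {
  ext :> structure L;
  ext_emb : M -> ext;
  ext_elem : forall n (phi : formula L M n) (v : 'I_n -> M),
    sat id phi v <-> sat ext_emb phi (fun i => ext_emb (v i)) }.

(* [saturated N K]: [N] is |K|-saturated. *)
Definition saturated (L : language) (N : structure L) (K : Type) : Prop :=
  forall A : set N, card_lt A [set: K] ->
  forall n (Phi : set (formula L A n)),
    finitely_satisfiable (val : A -> N) Phi ->
    exists v, satisfies (val : A -> N) Phi v.

(* The group defined in [N] by the formula [phi] (underlying set) and the
   formula [mu] (graph of the multiplication); [gemb] identifies its elements
   with the tuples of [N] realizing [phi]. *)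
Record definable_group (L : language) (A : Type) (N : structure L)
    (par : A -> N) n (phi : formula L A n) (mu : formula L A (n + (n + n))) :=
  DefinableGroup {
  gcarrier :> groupType;
  gemb : gcarrier -> 'I_n -> N;
  gemb_inj : injective gemb;
  gemb_dom : forall v, sat par phi v <-> exists x, gemb x = v;
  gemb_mul : forall x y z,
    sat par mu (tcat (gemb x) (tcat (gemb y) (gemb z))) <-> (x * y)%g = z }.

Section Flows.
Variable G : groupType.

(* Flows are nonempty (an empty flow would be vacuously minimal).  The inverse
   of [act g] is [act g^-1], so continuity of each [act g] says that [G] acts
   by homeomorphisms. *)
Definition is_flow (X : topologicalType) (act : G -> X -> X) : Prop :=
  [/\ [set: X] !=set0, compact [set: X], hausdorff_space X &
    [/\ forall x, act 1%g x = x,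
        forall g h x, act (g * h)%g x = act g (act h x)
      & forall g, continuous (act g)]].

Definition orbit (X : Type) (act : G -> X -> X) (x : X) : set X :=
  range (act^~ x).

Definition is_ambit (X : topologicalType) (act : G -> X -> X) (x0 : X) : Prop :=
  is_flow act /\ dense (orbit act x0).

Definition minimal (X : topologicalType) (act : G -> X -> X) : Prop :=
  forall x, dense (orbit act x).

(* [{ptws X -> R}] is R^X with the product topology. *)
Definition wap (R : realType) (X : topologicalType) (act : G -> X -> X) :
    Prop :=
  forall f : X -> R, continuous f ->
  forall h : {ptws X -> R},
    closure (range (fun g => (fun x => f (act g x)) : {ptws X -> R})) h ->
    continuous (h : X -> R).

Definition flow_map (X Y : topologicalType) (actX : G -> X -> X)
    (actY : G -> Y -> Y) (f : X -> Y) : Prop :=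
  continuous f /\ forall g x, f (actX g x) = actY g (f x).

Definition flow_iso (X Y : topologicalType) (actX : G -> X -> X)
    (actY : G -> Y -> Y) (f : X -> Y) : Prop :=
  flow_map actX actY f /\
  exists f' : Y -> X, [/\ cancel f f', cancel f' f & flow_map actY actX f'].

End Flows.

Section DefinableFlows.
Variables (R : realType) (L : language) (M : structure L).
Variables (n : nat) (phi : formula L M n) (mu : formula L M (n + (n + n))).
Variable G : definable_group id phi mu.

Definition definable_subset (Z : set G) : Prop :=
  exists psi : formula L M n, Z = [set g | sat id psi (gemb g)].

Definition definable_map (X : topologicalType) (h : G -> X) : Prop :=
  forall C1 C2 : set X, closed C1 -> closed C2 -> C1 `&` C2 = set0 ->
  exists Z, [/\ definable_subset Z, h @^-1` C1 `<=` Z & h @^-1` C2 `<=` ~` Z].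

Definition definable_flow (X : topologicalType) (act : G -> X -> X) : Prop :=
  forall x, definable_map (act^~ x).

Definition definable_wap_ambit (X : topologicalType) (act : G -> X -> X)
    (x0 : X) : Prop :=
  [/\ is_ambit act x0, definable_flow act & wap R act].

Definition universal_definable_wap_ambit (X : topologicalType)
    (act : G -> X -> X) (x0 : X) : Prop :=
  definable_wap_ambit act x0 /\
  forall (Y : topologicalType) (actY : G -> Y -> Y) (y0 : Y),
    definable_wap_ambit actY y0 ->
    exists f : X -> Y,
      [/\ flow_map act actY f, set_surj setT setT f & f x0 = y0].

Definition minimal_definable_wap_flow (X : topologicalType)
    (act : G -> X -> X) : Prop :=
  [/\ is_flow act, minimal act, definable_flow act & wap R act].

Definition universal_minimal_definable_wap_flow (X : topologicalType)
    (act : G -> X -> X) : Prop :=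
  minimal_definable_wap_flow act /\
  forall (Y : topologicalType) (actY : G -> Y -> Y),
    minimal_definable_wap_flow actY ->
    exists f : X -> Y, flow_map act actY f /\ set_surj setT setT f.

End DefinableFlows.
Arguments definable_wap_ambit R {L M n phi mu} G {X}.
Arguments universal_definable_wap_ambit R {L M n phi mu} G {X}.
Arguments minimal_definable_wap_flow R {L M n phi mu} G {X}.
Arguments universal_minimal_definable_wap_flow R {L M n phi mu} G {X}.

Section TypeSpace.
Variables (L : language) (M : structure L) (n : nat) (phi : formula L M n).

Definition type_space : Type :=
  {p : set (formula L M n) | complete_type id p /\ p phi}.

HB.instance Definition _ := gen_eqMixin type_space.
HB.instance Definition _ := gen_choiceMixin type_space.

Definition type_basic (psi : formula L M n) : set type_space :=
  [set p | sval p psi].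

HB.instance Definition _ :=
  isSubBaseTopological.Build type_space (range type_basic) id.

Lemma type_ext (p q : type_space) :
  (forall psi, sval p psi <-> sval q psi) -> p = q.
Proof.
case: p q => [p Hp] [q Hq] /= pq.
have E : p = q by apply/funext => psi; apply/propext.
by subst q; congr exist; exact: Prop_irrelevance.
Qed.

Lemma type_basic_open psi : open (type_basic psi).
Proof.
exists [set type_basic psi]; last by rewrite bigcup_set1.
move=> _ ->; exists [fset type_basic psi]%fset.
  by move=> A /fset1P ->; rewrite inE; exists psi.
by rewrite set_fset1 bigcap_set1.
Qed.

Variables (mu : formula L M (n + (n + n))) (G : definable_group id phi mu).

Lemma realized_type (a : G) :
  complete_type id [set psi | sat id psi (gemb a)] /\ sat id phi (gemb a).
Proof.
split; last by apply/(gemb_dom G); exists a.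
split=> [Psi _ PsiS|psi]; first by exists (gemb a).
by have [|] := pselect (sat id psi (gemb a)); [left|right].
Qed.

Definition tp (a : G) : type_space :=
  exist _ [set psi | sat id psi (gemb a)] (realized_type a).

(* psi(g x), written  exists z, phi(z) /\ mu(g, x, z) /\ psi(z)  where z is the
   block of variables bound by [exs]. *)
Definition ltranslate (g : G) (psi : formula L M n) : formula L M n :=
  let x i : term L M (n + n) := TVar (rshift n i) in
  let z i : term L M (n + n) := TVar (lshift n i) in
  exs (FAnd (subst phi z)
      (FAnd (subst mu (tcat (fun i => TPar (gemb g i)) (tcat x z)))
            (subst psi z))).

Lemma sat_ltranslate (g x : G) psi :
  sat id (ltranslate g psi) (gemb x) <-> sat id psi (gemb (g * x)%g).
Proof.
have zE (w v : 'I_n -> M) :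
    (fun i => teval id (tcat w v) (TVar (lshift n i) : term L M (n + n))) = w.
  by apply/funext => i /=; rewrite /tcat -[lshift n i]/(unsplit (inl i)) unsplitK.
have muE (w v : 'I_n -> M) :
    (fun i => teval id (tcat w v)
      (tcat (fun i => TPar (gemb g i)) (tcat (fun i => TVar (rshift n i))
        (fun i => TVar (lshift n i))) i : term L M (n + n))) =
    tcat (gemb g) (tcat v w).
  apply/funext => i; rewrite {2 4}/tcat; case: (fintype.split i) => //= k.
  rewrite {2 3}/tcat; case: (fintype.split k) => //= l; rewrite /tcat.
    by rewrite -[rshift n l]/(unsplit (inr l)) unsplitK.
  by rewrite -[lshift n l]/(unsplit (inl l)) unsplitK.
rewrite /ltranslate sat_exs; split.
  move=> [w /= [H1 [H2 H3]]].
  move: ((sat_subst _ _ _ _).1 H1) ((sat_subst _ _ _ _).1 H2)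
    ((sat_subst _ _ _ _).1 H3).
  rewrite !zE muE => /(gemb_dom G)[z <-] mz.
  by rewrite ((gemb_mul _ _ _).1 mz).
move=> pgx; exists (gemb (g * x)%g); split; [|split].
- by apply/sat_subst; rewrite zE; apply/(gemb_dom G); exists (g * x)%g.
- by apply/sat_subst; rewrite muE; apply/gemb_mul.
- by apply/sat_subst; rewrite zE.
Qed.

Lemma type_realize (p : type_space) (Psi : set (formula L M n)) :
  finite_set Psi -> Psi `<=` sval p ->
  exists x : G, forall psi, Psi psi -> sat id psi (gemb x).
Proof.
case: p => [p [[fs _] pphi]] /= Pfin Pp.
have [||v vs] := fs (phi |` Psi).
- by rewrite finite_setU; split; first exact: finite_set1.
- by move=> psi [->|/Pp].
have /(gemb_dom G)[x xv] : sat id phi v by apply: vs; left.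
by exists x => psi sps; rewrite xv; apply: vs; right.
Qed.

Lemma type_act_subproof (g : G) (p : type_space) :
  complete_type id [set psi | sval p (ltranslate g psi)] /\
  sval p (ltranslate g phi).
Proof.
have [pc _] := svalP p.
split; first split.
- move=> Psi Pfin Ps.
  have [||x xs] := @type_realize p (ltranslate g @` Psi).
  + exact: finite_image.
  + by move=> psi [chi /Ps ? <-].
  exists (gemb (g * x)%g) => psi Ppsi; apply/sat_ltranslate.
  by apply: xs; exists psi.
- move=> psi /=.
  have [|n1] := pc.2 (ltranslate g psi); first by left.
  have [|n2] := pc.2 (ltranslate g (FNot psi)); first by right.
  have [||x Hx] := @type_realize p
    [set FNot (ltranslate g psi); FNot (ltranslate g (FNot psi))].
  + by rewrite finite_setU; split; exact: finite_set1.
  + by move=> _ [->|->].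
  exfalso.
  have /= H1 := Hx _ (or_introl erefl).
  have /= H2 := Hx _ (or_intror erefl).
  by apply: H2; apply/sat_ltranslate => /= H; apply: H1; apply/sat_ltranslate.
have [//|n1] := pc.2 (ltranslate g phi).
have [||x Hx] := @type_realize p [set FNot (ltranslate g phi)].
- exact: finite_set1.
- by move=> _ ->.
exfalso; have /= := Hx _ erefl; apply.
by apply/sat_ltranslate/(gemb_dom G); exists (g * x)%g.
Qed.

(* g p = { psi(x) : psi(g x) in p } *)
Definition type_act (g : G) (p : type_space) : type_space :=
  exist _ [set psi | sval p (ltranslate g psi)] (type_act_subproof g p).

Lemma type_act_tp g a : type_act g (tp a) = tp (g * a)%g.
Proof. by apply: type_ext => psi /=; exact: sat_ltranslate. Qed.

Lemma type_act_continuous g : continuous (type_act g).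
Proof.
apply/continuousP => _ [D DfI <-]; rewrite preimage_bigcup.
apply: bigcup_open => A /DfI [E EB <-].
rewrite preimage_bigcap bigcap_fset big_seq.
elim/big_ind: _ => [|? ? ? ?|B BE]; [exact: openT|exact: openI|].
have /set_mem[psi _ <-] := EB _ BE.
exact: (type_basic_open (ltranslate g psi)).
Qed.

End TypeSpace.
Arguments tp {L M n phi mu G}.
Arguments type_act {L M n phi mu G}.

Section StableQuotient.
Local Open Scope ring_scope.
Local Open Scope quotient_scope.
Variables (R : realType) (L : language) (M : structure L).
Variables (n : nat) (phi : formula L M n) (mu : formula L M (n + (n + n))).
Variable G : definable_group id phi mu.

(* Stability in M of phi(x, y) = F(y x). *)
Definition stable_in (F : type_space phi -> R) : Prop :=
  forall eps : R, 0 < eps ->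
  ~ exists a b : nat -> G, forall i j, (i < j)%N ->
      eps <= `|F (tp (b j * a i)%g) - F (tp (b i * a j)%g)|.

Definition stable_algebra : set (type_space phi -> R) :=
  [set F | continuous F /\ stable_in F].

Definition stable_equiv (p q : type_space phi) : bool :=
  `[< forall F, stable_algebra F -> F p = F q >].

Lemma stable_equiv_equiv : equiv_class_of stable_equiv.
Proof.
split=> [p|p q|q p r]; first by apply/asboolP.
  by apply/asboolP/asboolP => pq F AF; rewrite pq.
by move=> /asboolP pq /asboolP qr; apply/asboolP => F AF; rewrite pq// qr.
Qed.

Canonical stable_equiv_rel := EquivRelPack stable_equiv_equiv.

Definition stable_space : topologicalType :=
  quotient_topology {eq_quot stable_equiv_rel}.

Definition stable_class (p : type_space phi) : stable_space :=
  \pi_{eq_quot stable_equiv_rel} p.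

(* The action induced on classes; see [stable_act_class]. *)
Definition stable_act (g : G) (s : stable_space) : stable_space :=
  stable_class (type_act g (repr (s : {eq_quot stable_equiv_rel}))).

Definition stable_base : stable_space := stable_class (tp (1%g : G)).

Lemma stable_algebra_act (g : G) F :
  stable_algebra F -> stable_algebra (F \o type_act g).
Proof.
move=> [Fc Fs]; split.
  by move=> p; apply: continuous_comp; [exact: type_act_continuous|exact: Fc].
move=> eps eps0 [a [b ab]]; apply: (Fs _ eps0).
exists a, (fun i => g * b i)%g => i j ij.
by have := ab i j ij; rewrite /= !type_act_tp !mulgA.
Qed.

Lemma stable_act_class (g : G) p :
  stable_act g (stable_class p) = stable_class (type_act g p).
Proof.
apply/eqmodP/asboolP => F AF.
have /eqmodP/asboolP := reprK (stable_class p : {eq_quot stable_equiv_rel}).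
by move=> /(_ _ (stable_algebra_act g AF)).
Qed.

End StableQuotient.
Arguments stable_act R {L M n phi mu} G.
Arguments stable_base R {L M n phi mu} G.

Section ConnectedComponent.
Variables (L : language) (M : structure L) (N : elementary_extension M).
Variables (n : nat) (phi : formula L M n) (mu : formula L M (n + (n + n))).
Variable G : definable_group id phi mu.
Variable Gs : definable_group (@ext_emb L M N) phi mu.
Variable K : Type.

Definition type_definable_over (A : Type) (par : A -> N) (X : set Gs) : Prop :=
  exists Phi : set (formula L A n),
    X = [set x | satisfies par Phi (gemb x)].

(* Type-definable over a small (of size < |K|) set of parameters. *)
Definition type_definable (X : set Gs) : Prop :=
  exists A : set N, card_lt A [set: K] /\
    type_definable_over (val : A -> N) X.

Definition subgroup (H : set Gs) : Prop :=
  [/\ H 1%g, forall x y, H x -> H y -> H (x * y)%g & forall x, H x -> H (x^-1)%g].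

Definition lcoset (H : set Gs) (x : Gs) : set Gs := [set (x * h)%g | h in H].

Definition bounded_index (H : set Gs) : Prop :=
  card_lt (range (lcoset H)) [set: K].

Definition bounded_type_definable_subgroup (H : set Gs) : Prop :=
  [/\ subgroup H, type_definable_over (@ext_emb L M N) H & bounded_index H].

Definition G00 : set Gs := \bigcap_(H in bounded_type_definable_subgroup) H.

Definition smallest_bounded_type_definable_subgroup (H : set Gs) : Prop :=
  bounded_type_definable_subgroup H /\
  forall H', bounded_type_definable_subgroup H' -> H `<=` H'.

Definition GmodG00 : Type := {C : set Gs | range (lcoset G00) C}.

Definition coset00 (x : Gs) : GmodG00 :=
  exist _ (lcoset G00 x) (ex_intro2 _ _ x I erefl).

HB.instance Definition _ := gen_eqMixin GmodG00.
HB.instance Definition _ := gen_choiceMixin GmodG00.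

(* The logic topology: the coarsest one in which the sets with a
   type-definable preimage in G are closed. *)
HB.instance Definition _ := isSubBaseTopological.Build GmodG00
  [set U | type_definable (coset00 @^-1` (~` U))] id.

Lemma gincl_subproof (g : G) : exists x : Gs, gemb x = @ext_emb L M N \o gemb g.
Proof.
apply/(gemb_dom Gs)/(ext_elem N phi (gemb g)).1.
by apply/(gemb_dom G); exists g.
Qed.

(* The inclusion of G(M) into G = G(N). *)
Definition gincl (g : G) : Gs := sval (cid (gincl_subproof g)).

Lemma act00_subproof (g : G) (C : GmodG00) :
  range (lcoset G00) [set (gincl g * y)%g | y in sval C].
Proof.
case: C => _ /= [x _ <-]; exists (gincl g * x)%g => //.
apply/seteqP; split=> [_ [h Hh <-]|_ [_ [h Hh <-] <-]].
  by exists (x * h)%g; rewrite ?mulgA//; exists h.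
by exists h; rewrite ?mulgA.
Qed.

Definition act00 (g : G) (C : GmodG00) : GmodG00 :=
  exist _ [set (gincl g * y)%g | y in sval C] (act00_subproof g C).

End ConnectedComponent.
Arguments type_definable {L M N n phi mu} Gs K.
Arguments smallest_bounded_type_definable_subgroup {L M N n phi mu} Gs K.
Arguments G00 {L M N n phi mu} Gs K.
Arguments GmodG00 {L M N n phi mu} Gs K.
Arguments coset00 {L M N n phi mu} Gs K.
Arguments act00 {L M N n phi mu} G Gs K.

(* Main.v *)
Require Import Defs.
From mathcomp Require Import all_boot all_order all_algebra finmap generic_quotient.
From mathcomp Require Import all_classical all_reals all_analysis.
From mathcomp Require Import lra ring.
(* Imported again because [fsym] is shadowed by MathComp. *)
Import Defs.
Import Order.TTheory GRing.Theory Num.Theory.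
Import numFieldNormedType.Exports.

(* By definability, an orbit map g |-> g x0 into a definable flow extends
   continuously to the type space S, and by the double limit criterion of
   Grothendieck a flow is wap exactly when the formulas F(g) = f(g x0) are
   stable.  Hence an ambit of S is definable and wap iff its functions pull
   back to stable formulas, and the quotient by all of them is universal.

   For (ii), a minimal wap flow Y is equicontinuous: an orbit closure of f is a
   weakly compact set of functions, so that uniformly separated families of
   points are countable, which excludes a binary tree of open sets of large
   diameter.  Equicontinuity makes x * y = lim g y (g tending to tp(x/M)) an
   action of G = G(N) on Y; its kernel is type-definable over M of bounded
   index, hence contains G00, and Y is a quotient of G/G00.  Conversely, types
   over M determine cosets of G00, so G/G00 is a closed image of S. *)

Set Implicit Arguments.
Unset Strict Implicit.
Unset Printing Implicit Defensive.

Local Open Scope classical_set_scope.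

(** * Cardinal arithmetic *)

(** Two obstacles shape the proof. Neither G(M) nor the flows are countable or metrizable, while the
    separation argument behind equicontinuity codes points by natural numbers. It still applies
    because a binary tree has only countably many nodes and so involves only countably many
    translates of f.

    Moreover G00 is an intersection of an unrestricted family of subgroups, so the bound on its
    index cannot come from the bounds on the members alone. Each member H is shown to contain x^-1 y
    whenever x and y have the same type over M. The intersection inherits this, so its index is at
    most the number of types, which is at most 2^(|M| + aleph0) < |K| because a countable complete
    theory has a countable language. Normality of G00 is not part of its definition either: it is
    obtained for conjugation by G(M), which preserves type-definability over M, and spread to G by
    density. The cardinal arithmetic serves to keep parameter sets small when constants are
    added. *)

Definition embeds (A B : Type) : Prop := exists f : A -> B, injective f.

Lemma embeds_trans B A C : embeds A B -> embeds B C -> embeds A C.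
Proof. by move=> [f fi] [g gi]; exists (g \o f); exact: inj_comp. Qed.

Lemma embeds_set_type (T : Type) (A : set T) : embeds A T.
Proof. by exists val; exact: val_inj. Qed.

Lemma card_le_embeds (T U : Type) (A : set T) (B : set U) :
  (A #<= B)%card <-> embeds A B.
Proof.
split=> [/card_leP[f]|[f fi]].
  by exists f => x y; apply: inj; rewrite inE.
by apply/card_leP/injfunPex; exists f => // x y _ _; exact: fi.
Qed.

Lemma embeds_setT (T : Type) : embeds T [set: T].
Proof.
exists (fun x => SigSub (mem_set (I : [set: T] x))) => x y /(congr1 val).
exact.
Qed.

Lemma card_le_setT (T U : Type) (A : set T) :
  (A #<= [set: U])%card <-> embeds A U.
Proof.
rewrite card_le_embeds; split=> AU.
  exact: embeds_trans AU (embeds_set_type _).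
exact: embeds_trans AU (embeds_setT _).
Qed.

Lemma card_ge_setT (T U : Type) (A : set T) :
  ([set: U] #<= A)%card <-> embeds U A.
Proof.
rewrite card_le_embeds; split=> AU.
  exact: embeds_trans (embeds_setT _) AU.
exact: embeds_trans (embeds_set_type _) AU.
Qed.

(** A maximal partial injection, given by its graph, is total or onto: otherwise a pair of missed
    points could be added to it. *)
Lemma embeds_total (A B : Type) : embeds A B \/ embeds B A.
Proof.
pose P (G : set (A * B)) := (forall a b b', G (a, b) -> G (a, b') -> b = b') /\
  (forall a a' b, G (a, b) -> G (a', b) -> a = a').
have [|G [[Gf Gi] Gmax]] := @Zorn_bigcup _ P.
  move=> F FP Ft; split=> [a b b'|a a' b] [X FX Xa] [Y FY Ya];
  have [XY|YX] := Ft _ _ FX FY.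
  - exact: ((FP _ FY).1 a b b' (XY _ Xa)).
  - exact: ((FP _ FX).1 a b b' _ (YX _ Ya)).
  - exact: ((FP _ FY).2 a a' b (XY _ Xa)).
  - exact: ((FP _ FX).2 a a' b _ (YX _ Ya)).
have [tot|/existsNP[a aP]] := pselect (forall a, exists b, G (a, b)).
  left; exists (fun a => sval (cid (tot a))) => a a'.
  case: cid => b /= ab; case: cid => b' /= ab' bb'.
  by apply: Gi ab _; rewrite bb'.
have [sur|/existsNP[b bP]] := pselect (forall b, exists a, G (a, b)).
  right; exists (fun b => sval (cid (sur b))) => b b'.
  case: cid => c /= ab; case: cid => c' /= ab' bb'.
  by apply: Gf ab _; rewrite bb'.
exfalso; apply: (Gmax (G `|` [set (a, b)])).
  split=> [x Gx|H]; first by left.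
  by apply: aP; exists b; apply: H; right.
split=> [x y y'|x x' y] [Gx|/= [? ?]] [Gx'|/= [? ?]]; subst=> //.
- exact: Gf Gx Gx'.
- by exfalso; apply: aP; exists y.
- by exfalso; apply: aP; exists y'.
- exact: Gi Gx Gx'.
- by exfalso; apply: bP; exists x.
- by exfalso; apply: bP; exists x'.
Qed.

(* Hessenberg's theorem.  By Zorn, take a maximal infinite Y with an injection
   f of Y * Y into Y.  If Y embedded in its complement, with image Y', then f
   would extend to (Y u Y')^2, sending the new pairs injectively into Y'; so
   the complement embeds in Y, and X embeds in Y + Y, hence in Y. *)
Lemma embeds_square (X : Type) : embeds nat X -> embeds (X * X) X.
Proof.
move=> [e ei].
pose D (G : set ((X * X) * X)) : set X := [set x | exists z, G ((x, x), z)].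
(* [G] is the graph of an injection of the square of [D G] into [D G]. The last clause keeps [D G]
   infinite; it is conditional because the empty chain must have a union in [P]. *)
pose P (G : set ((X * X) * X)) := [/\
  forall p z z', G (p, z) -> G (p, z') -> z = z',
  forall p p' z, G (p, z) -> G (p', z) -> p = p',
  forall x y, D G x -> D G y -> exists z, G ((x, y), z),
  forall x y z, G ((x, y), z) -> [/\ D G x, D G y & D G z]
  & forall g, G g -> range e `<=` D G].
have Dmono G G' : G `<=` G' -> D G `<=` D G'.
  by move=> GG' x [z xz]; exists z; exact: GG'.
have [|G [[Gf Gi Gt Gr Ge] Gmax]] := @Zorn_bigcup _ P.
  move=> F FP Ft; pose U := \bigcup_(X in F) X.
  have Fsub W : F W -> W `<=` U by move=> FW x Wx; exists W.
  have two (g g' : (X * X) * X) : U g -> U g' ->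
      exists W, [/\ F W, W g & W g'].
    move=> [Y FY Yg] [Z FZ Zg'].
    by have [YZ|ZY] := Ft _ _ FY FZ; [exists Z|exists Y]; split; auto.
  split.
  - move=> p z z' Uz Uz'; have [W [FW Wz Wz']] := two _ _ Uz Uz'.
    by have [Wf _ _ _ _] := FP _ FW; exact: Wf Wz Wz'.
  - move=> p p' z Uz Uz'; have [W [FW Wz Wz']] := two _ _ Uz Uz'.
    by have [_ Wi _ _ _] := FP _ FW; exact: Wi Wz Wz'.
  - move=> x y [z Uz] [z' Uz']; have [W [FW Wz Wz']] := two _ _ Uz Uz'.
    have [_ _ Wt _ _] := FP _ FW; have [||t Wxt] := Wt x y.
    + by exists z.
    + by exists z'.
    + by exists t; exists W.
  - move=> x y z [W FW Wz]; have [_ _ _ Wr _] := FP _ FW.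
    have [Dx Dy Dz] := Wr _ _ _ Wz.
    by split; apply: (Dmono W) => //; exact: Fsub.
  - move=> g [W FW Wg]; have [_ _ _ _ We] := FP _ FW.
    by apply: subset_trans (We _ Wg) _; apply: Dmono; exact: Fsub.
have eG : range e `<=` D G.
  have [[g Gg]|G0] := pselect (exists g, G g); first exact: Ge Gg.
  (* The empty graph is not maximal: a pairing of natural numbers, transported along [e], extends
     it. *)
  exfalso; have [h hi] : embeds (nat * nat) nat.
    by exists choice.pickle; exact: pcan_inj choice.pickleK.
  pose G' : set ((X * X) * X) := [set (((e q.1.1, e q.1.2)), e q.2) | q in
     [set q : (nat * nat) * nat | h q.1 = q.2]].
  apply: (Gmax G').
    split=> [x Gx|H]; first by exfalso; apply: G0; exists x.
    apply: G0; exists ((e 0%N, e 0%N), e (h (0%N, 0%N))); apply: H.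
    by exists ((0%N, 0%N), h (0%N, 0%N)).
  have DG' : D G' = range e.
    apply/seteqP; split=> [x [z [[[m k] l] /= _ [<- _ _]]]|_ [m _ <-]].
      by exists m.
    by exists (e (h (m, m))); exists ((m, m), h (m, m)).
  split.
  - move=> p z z' [[[m k] l] /= hl [<- <-]] [[[m' k'] l'] /= hl'].
    by move=> [] /ei mm /ei kk <-; rewrite -hl -hl' mm kk.
  - move=> p p' z [[[m k] l] /= hl [<- <-]] [[[m' k'] l'] /= hl'].
    move=> [] <- /ei ll; have [] : (m, k) = (m', k').
      by apply: hi; rewrite hl hl' ll.
    by move=> -> ->.
  - rewrite DG' => _ _ [m _ <-] [k _ <-]; exists (e (h (m, k))).
    by exists ((m, k), h (m, k)).
  - by move=> x y z [[[m k] l] /= hl [<- <- <-]]; rewrite DG'; split;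
      [exists m|exists k|exists l].
  - by move=> g _; rewrite DG'.
pose Y : Type := D G.
have [f fP] : {f : Y -> Y -> Y & forall x y, G ((val x, val y), val (f x y))}.
  apply: (@choice _ _ (fun (x : Y) (g : Y -> Y) =>
    forall y, G ((val x, val y), val (g y)))) => x.
  have [|g gP] := @choice _ _ (fun (y z : Y) => G ((val x, val y), val z)).
    move=> y; have [z xyz] := Gt _ _ (set_valP x) (set_valP y).
    by have [_ _ Dz] := Gr _ _ _ xyz; exists (SigSub (mem_set Dz)).
  by exists g.
have fi x y x' y' : f x y = f x' y' -> x = x' /\ y = y'.
  move=> ff; have := fP x' y'; rewrite -ff => /(Gi _ _ _ (fP x y))[].
  by move=> /val_inj -> /val_inj ->.
(* With two distinct points, [f t0] and [f t1] embed two disjoint copies of [Y] in [Y]. *)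
pose t0 : Y := SigSub (mem_set (eG _ (imageT e 0%N))).
pose t1 : Y := SigSub (mem_set (eG _ (imageT e 1%N))).
have t01 : t0 <> t1 by move=> /(congr1 val)/ei.
have inY x : D G x -> {y : Y | val y = x}.
  by move=> Dx; exists (SigSub (mem_set Dx)).
have YX : embeds Y X by exact: embeds_set_type.
have [[j ji]|[j ji]] := embeds_total Y (~` D G); last first.
  suff [c ci] : embeds X Y.
    exists (fun p => val (f (c p.1) (c p.2))) => -[x y] [x' y'] /= /val_inj.
    by move=> /fi[/ci -> /ci ->].
  pose c x := if pselect (D G x) is left Dx then f t0 (sval (inY x Dx)) else
    if pselect ((~` D G) x) is left Dx then f t1 (j (SigSub (mem_set Dx)))
    else t0.
  exists c => x y; rewrite /c.
  case: (pselect (D G x)) => Dx; case: (pselect (D G y)) => Dy.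
  - by case: (inY x Dx) => x' /= <-; case: (inY y Dy) => y' /= <- /fi[_ ->].
  - by case: pselect => // ? /fi[].
  - by case: pselect => // ? /fi[/esym].
  - case: pselect => // Dx'; case: pselect => // Dy' /fi[_ /ji].
    by move/(congr1 val).
exfalso.
(* [c] codes the points of the union of Y and Y' = j(Y) by points of Y. *)
pose Y' : set X := range (fun y => val (j y)).
pose c (x : X) (y : Y) := (exists u, val u = x /\ y = f t0 u) \/
   (exists u, val (j u) = x /\ y = f t1 u).
have jD (u v : Y) : val (j u) <> val v.
  by move=> uv; have := set_valP (j u); apply; rewrite uv; exact: set_valP.
have cf x y y' : c x y -> c x y' -> y = y'.
  move=> [[u [<- ->]]|[u [<- ->]]] [[v [E ->]]|[v [E ->]]].
  - by move/val_inj: E => ->.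
  - by have := jD v u; rewrite E.
  - by have := jD u v; rewrite E.
  - by move/val_inj/ji: E => ->.
have ci x x' y : c x y -> c x' y -> x = x'.
  move=> [[u [<- ->]]|[u [<- ->]]] [[v [<-]]|[v [<-]]] /fi[].
  - by move=> _ ->.
  - by move/t01.
  - by move/esym/t01.
  - by move=> _ ->.
pose G' : set ((X * X) * X) := G `|` [set p |
  [/\ ~ (D G p.1.1 /\ D G p.1.2) & exists a b, [/\ c p.1.1 a, c p.1.2 b &
      p.2 = val (j (f a b))]]].
have DG' : D G' = D G `|` Y'.
  apply/seteqP; split=> [x [z [Gz|/= [nD [a [b [ca cb _]]]]]]|x].
  - by left; exists z.
  - case: ca => [[u [<- _]]|[u [<- _]]]; first by left; exact: set_valP.
    by right; exists u.
  - move=> [[z xz]|[u _ <-]]; first by exists z; left.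
    have cu : c (val (j u)) (f t1 u) by right; exists u.
    exists (val (j (f (f t1 u) (f t1 u)))); right; split => /=.
      by move=> [/(set_valP (j u))].
    by exists (f t1 u), (f t1 u).
have cD x : D G' x -> exists y, c x y.
  rewrite DG' => -[Dx|[u _ <-]]; last by exists (f t1 u); right; exists u.
  by have [u ux] := inY _ Dx; exists (f t0 u); left; exists u.
have Dc x y : c x y -> D G' x.
  rewrite DG' => -[[u [<- _]]|[u [<- _]]]; first by left; exact: set_valP.
  by right; exists u.
apply: (Gmax G').
  split=> [x Gx|H]; first by left.
  apply: (set_valP (j t0)).
  apply: (Dmono _ _ H); rewrite DG'; by right; exists t0.
split.
- move=> p z z' [Gz|[nD [a [b [ca cb E]]]]] [Gz'|[nD' [a' [b' [ca' cb' E']]]]].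
  + exact: Gf Gz Gz'.
  + by rewrite [p]surjective_pairing in Gz; have [Dx Dy _] := Gr _ _ _ Gz; case: nD'.
  + by rewrite [p]surjective_pairing in Gz'; have [Dx Dy _] := Gr _ _ _ Gz'; case: nD.
  + by rewrite /= in E E' *; rewrite E E' (cf _ _ _ ca ca') (cf _ _ _ cb cb').
- move=> p p' z [Gz|[nD [a [b [ca cb E]]]]] [Gz'|[nD' [a' [b' [ca' cb' E']]]]].
  + exact: Gi Gz Gz'.
  + rewrite [p]surjective_pairing in Gz; have [_ _ Dz] := Gr _ _ _ Gz.
    by exfalso; apply: (set_valP (j (f a' b'))); rewrite -E'.
  + rewrite [p']surjective_pairing in Gz'; have [_ _ Dz] := Gr _ _ _ Gz'.
    by exfalso; apply: (set_valP (j (f a b))); rewrite -E.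
  + rewrite /= in E E'; move: E'; rewrite E => /val_inj/ji/fi[aa bb]; subst.
    case: p p' ca cb ca' cb' {nD nD'} => x y [x' y'] /= ca cb ca' cb'.
    by rewrite (ci _ _ _ ca ca') (ci _ _ _ cb cb').
- move=> x y Dx Dy; have [[Dx' Dy']|nD] := pselect (D G x /\ D G y).
    by have [z xyz] := Gt _ _ Dx' Dy'; exists z; left.
  have [a ca] := cD _ Dx; have [b cb] := cD _ Dy.
  by exists (val (j (f a b))); right; split=> //; exists a, b.
- move=> x y z [Gz|[/= nD [a [b [ca cb ->]]]]].
    by have [Dx Dy Dz] := Gr _ _ _ Gz; rewrite DG'; split; left.
  split; [exact: Dc ca|exact: Dc cb|].
  by rewrite DG'; right; exists (f a b).
- by move=> _ _; rewrite DG' => x ex; left; exact: (eG _ ex).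
Qed.

(* An embedding of K * K in A + B either maps some row into A, or meets B in
   every row. *)
Lemma embeds_sum (K A B : Type) :
  embeds nat K -> embeds K (A + B) -> embeds K A \/ embeds K B.
Proof.
move=> /embeds_square KK KAB; have [h hi] := embeds_trans KK KAB.
have [[k kA]|kA] := pselect (exists k, forall l, exists a, h (k, l) = inl a).
  left; exists (fun l => sval (cid (kA l))) => l l'.
  by case: cid => a /= ha; case: cid => a' /= ha' aa; move: ha; rewrite aa -ha' => /hi[].
right; have kB k : exists b, exists l, h (k, l) = inr b.
  apply: contrapT => nb; apply: kA; exists k => l.
  case E : (h (k, l)) => [a|b]; first by exists a.
  by exfalso; apply: nb; exists b, l.
exists (fun l => sval (cid (kB l))) => l l'.
case: cid => a /= [k ha]; case: cid => a' /= [k' ha'] aa.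
by move: ha; rewrite aa -ha' => /hi[].
Qed.

(** The length is coded beside the iterated pairing, which alone does not show where the list
    ends. *)
Lemma embeds_seq (X : Type) : embeds nat X -> embeds (seq X) X.
Proof.
move=> [e ei]; have [h hi] := embeds_square (ex_intro _ e ei).
pose c (s : seq X) := foldr (fun a acc => h (a, acc)) (e 0%N) s.
exists (fun s => h (e (size s), c s)) => s t /hi[/ei].
elim: s t => [|a s IH] [|b t]//= [st] /hi[-> /IH E].
by rewrite E.
Qed.

(** * The number of formulas *)

Section CountFormulas.
Variables (L : language) (A : Type).
Variables (fc : fsym L -> nat) (rc : rsym L -> nat).
Hypotheses (fcI : injective fc) (rcI : injective rc).

(** No brackets are needed for unique decoding: a tag gives the shape, and a symbol fixes how many
    arguments follow. *)
Fixpoint term_code n (t : term L A n) : seq (A + nat) :=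
  match t with
  | TVar i => [:: inr 0%N; inr (nat_of_ord i)]
  | TPar a => [:: inr 1%N; inl a]
  | TApp f args => inr 2%N :: inr (fc f) ::
      flatten [seq term_code (args i) | i <- enum 'I_(farity f)]
  end.

Fixpoint formula_code n (p : formula L A n) : seq (A + nat) :=
  match p with
  | FEq _ t u => inr 0%N :: term_code t ++ term_code u
  | FRel _ r args => inr 1%N :: inr (rc r) ::
      flatten [seq term_code (args i) | i <- enum 'I_(rarity r)]
  | FNot _ p => inr 2%N :: formula_code p
  | FAnd _ p q => inr 3%N :: formula_code p ++ formula_code q
  | FEx _ p => inr 4%N :: formula_code p
  end.

Lemma flatten_code_inj (B : Type) (k : nat) (c : B -> seq (A + nat))
    (x y : 'I_k -> B) :
  (forall i (b : B) s s', c (x i) ++ s = c b ++ s' -> x i = b /\ s = s') ->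
  forall s s', flatten [seq c (x i) | i <- enum 'I_k] ++ s =
    flatten [seq c (y i) | i <- enum 'I_k] ++ s' -> x = y /\ s = s'.
Proof.
move=> xi s s' E.
suff [xy ss] : {in enum 'I_k, x =1 y} /\ s = s'.
  by split=> //; apply/funext => i; apply: xy; rewrite mem_enum.
elim: (enum 'I_k) E => [|i l IH] /=; first by [].
rewrite -!catA => /xi[xy /IH[IHxy ss]]; split=> // j.
by rewrite inE => /predU1P[->//|/IHxy].
Qed.

(** The arbitrary suffixes say that no code is a proper prefix of another, which is the form that
    passes through concatenations. *)
Lemma term_code_inj n (t u : term L A n) s s' :
  term_code t ++ s = term_code u ++ s' -> t = u /\ s = s'.
Proof.
elim: t u s s' => [i|a|f args IH] [j|b|g args'] s s' //=.
- by case=> /val_inj -> ->.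
- by case=> -> ->.
- case=> /fcI fg; subst g => E.
  by have [-> ->] := flatten_code_inj IH E.
Qed.

Lemma formula_code_inj n (p q : formula L A n) s s' :
  formula_code p ++ s = formula_code q ++ s' -> p = q /\ s = s'.
Proof.
elim: p q s s' => {n} [n t u|n r args|n p IH|n p IHp p' IHp'|n p IH] q s s'.
- case: n / q t u => //= n t' u' t u [].
  by rewrite -!catA => /term_code_inj[-> /term_code_inj[-> ->]].
- case: n / q args => //= n r' args' args [] /rcI rr; subst r'.
  move=> /flatten_code_inj[|-> ->//] i b.
  exact: term_code_inj.
- by case: n / q p IH => //= n q p IH [] /IH[-> ->].
- case: n / q p IHp p' IHp' => //= n q q' p IHp p' IHp' [].
  by rewrite -!catA => /IHp[-> /IHp'[-> ->]].
- by case: n / q p IH => //= n q p IH [] /IH[-> ->].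
Qed.

Lemma embeds_formula n : embeds (formula L A n) (A + nat).
Proof.
have [|h hi] := @embeds_seq (A + nat).
  by exists inr => x y [].
exists (h \o @formula_code n) => p q /hi E.
have : formula_code p ++ [::] = formula_code q ++ [::] by rewrite E.
by case/formula_code_inj.
Qed.

End CountFormulas.

Section CountableTheory.
Variables (L : language) (M : structure L).
Hypothesis countable_theory : countable (theory M).

Lemma theory_complete (sigma : formula L void 0) :
  theory M sigma \/ theory M (FNot sigma).
Proof.
have [s|ns] := pselect (theory M sigma); [by left|right => v /= sv].
apply: ns => w; suff -> : w = v by [].
by apply/funext => -[].
Qed.

Fixpoint head_rsym n (p : formula L void n) : option (rsym L) :=
  match p with
  | FRel _ r _ => Some r
  | FNot _ p => head_rsym p
  | FEx _ p => head_rsym p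
  | _ => None
  end.

Fixpoint head_fsym n (p : formula L void n) : option (fsym L) :=
  match p with
  | FEq _ (TApp f _) _ => Some f
  | FNot _ p => head_fsym p
  | FEx _ p => head_fsym p
  | _ => None
  end.

(** The theory is complete, so for each symbol [x] it contains the sentence [s x] or its negation,
    and [hd] recovers [x] from either. *)
Lemma embeds_sym (S : Type) (hd : formula L void 0 -> option S)
    (s : S -> formula L void 0) :
  (forall p, hd (FNot p) = hd p) -> (forall x, hd (s x) = Some x) ->
  embeds S nat.
Proof.
move=> hN hs; have [c ci] : embeds (theory M) nat.
  exact/(card_le_setT nat (theory M)).
have tP x : exists t : theory M, hd (val t) = Some x.
  have [t|t] := theory_complete (s x); exists (SigSub (mem_set t)) => /=.
    exact: hs.
  by rewrite hN hs.
exists (fun x => c (sval (cid (tP x)))) => x y /ci.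
case: cid => t /= tx; case: cid => u /= uy E.
by move: tx; rewrite E uy => -[].
Qed.

Lemma embeds_rsym : embeds (rsym L) nat.
Proof.
apply: (@embeds_sym _ (@head_rsym 0)
  (fun r => FEx (FRel (fun _ : 'I_(rarity r) => TVar (ord0 : 'I_1))))) => //.
Qed.

Lemma embeds_fsym : embeds (fsym L) nat.
Proof.
apply: (@embeds_sym _ (@head_fsym 0) (fun f =>
  FEx (FEq (TApp (fun _ : 'I_(farity f) => TVar (ord0 : 'I_1)))
    (TVar (ord0 : 'I_1))))) => //.
Qed.

Lemma embeds_formula_theory n : embeds (formula L M n) (M + nat).
Proof.
have [rc rci] := embeds_rsym; have [fc fci] := embeds_fsym.
exact: embeds_formula fci rci n.
Qed.

End CountableTheory.

(** * Compact spaces and pointwise limits *)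

(** Dependent choice over the list of all previous terms. Only the first [n] values of the given
    sequence matter, so a list padded with [a0] is an admissible argument. *)
Lemma pairwise_sequence (A : Type) (Q : A -> A -> Prop) :
  (forall n (u : nat -> A), exists a, forall i, (i < n)%N -> Q (u i) a) ->
  inhabited A -> exists u, forall i j, (i < j)%N -> Q (u i) (u j).
Proof.
move=> ex [a0].
have [f fP] := choice (fun l : seq A => ex (size l) (nth a0 l)).
pose s := fix s n := if n is m.+1 then rcons (s m) (f (s m)) else [::].
have sE n : s n = mkseq (f \o s) n.
  elim: n => //= n IH; rewrite mkseqS -IH //.
exists (f \o s) => i j ij; have := fP (s j) i.
by rewrite {1 2}sE size_mkseq nth_mkseq// => /(_ ij).
Qed.

Lemma pairwise_sequence_filter (I : Type) (F : set_system I)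
    (FF : ProperFilter F) (E : I -> I -> Prop) :
  (\forall i \near F, \forall j \near F, E i j) ->
  exists u : nat -> I, forall i j, (i < j)%N -> E (u i) (u j).
Proof.
(* Terms are kept in [A], so that a new term has to meet only finitely many sets of [F]. *)
move=> FE; pose A := {i | F (E i)}.
have [i0 Fi0] := filter_ex FE.
have [||u uE] := @pairwise_sequence A (fun i j => E (sval i) (sval j)).
- move=> n u.

  suff /(filterI FE)/filter_ex[j [Fj jE]] :
      F [set j | forall i, (i < n)%N -> E (sval (u i)) j].
    by exists (exist _ j Fj).
  elim: n => [|n IH]; first exact: filterE.
  apply: filterS2 (svalP (u n)) IH => j nj IH i.
  by rewrite ltnS leq_eqVlt => /predU1P[->|/IH].
- by split; exists i0.
- by exists (fun n => sval (u n)).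
Qed.

Section Separation.
Variables (X : topologicalType).
Hypotheses (XT2 : hausdorff_space X) (Xc : compact [set: X]).

Lemma compact_separator (R : realType) (A B : set X) :
  closed A -> closed B -> A `&` B = set0 ->
  exists f : X -> R, [/\ continuous f, forall x, A x -> f x = 0%R
    & forall x, B x -> f x = 1%R].
Proof.
move=> cA cB AB.
have /normal_separatorP := compact_normal XT2 Xc.
move=> /(_ R _ _ cA cB AB)/uniform_separatorP.
move=> /(_ R)[f [fc _ fA fB]]; exists f; split=> // x ?.
  by apply: fA; exists x.
by apply: fB; exists x.
Qed.

Lemma compact_closed_set1 (x : X) : closed [set x].
Proof. exact/accessible_closed_set1/hausdorff_accessible. Qed.

Lemma continuous_separates (R : realType) (x y : X) :
  (forall f : X -> R, continuous f -> f x = f y) -> x = y.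
Proof.
move=> xy; apply: contrapT => nxy.
have [|||f [fc fx fy]] := @compact_separator R [set x] [set y].
- exact: compact_closed_set1.
- exact: compact_closed_set1.
- by apply/seteqP; split=> // z [/= -> /nxy].
- have := xy _ fc; rewrite fx// fy// => /eqP.
  by rewrite eq_sym oner_eq0.
Qed.

Lemma compact_regular_open (x : X) (U : set X) : nbhs x U ->
  exists V, [/\ open V, V x & closure V `<=` U].
Proof.
move=> xU; have [|V xV VU] := compact_regular XT2 Xc (x := x) _ xU.
  exact: filterT.
exists V°; split.
- exact: open_interior.
- exact: xV.
- by apply: subset_trans VU; apply: closureS; exact: interior_subset.
Qed.

End Separation.

Lemma dense_eq (T X : topologicalType) (D : set T) (f g : T -> X) :
  dense D -> hausdorff_space X -> continuous f -> continuous g ->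
  (forall x, D x -> f x = g x) -> f = g.
Proof.
move=> dD XT2 fc gc fg; apply/funext => x; apply: contrapT => /eqP nfg.
move: XT2; rewrite open_hausdorff => /(_ _ _ nfg)[[A B] /=].
rewrite !inE => -[Ax Bx] [oA oB AB].
have [|| y [[fy gy] Dy]] := dD (f @^-1` A `&` g @^-1` B).
- by exists x.
- by apply: openI; apply: open_comp.
- have : (A `&` B) (f y) by split=> //; rewrite fg.
  by rewrite AB.
Qed.

Lemma image_dense_surj (X Y : topologicalType) (f : X -> Y) (D : set Y) :
  compact [set: X] -> hausdorff_space Y -> continuous f -> dense D ->
  D `<=` range f -> set_surj setT setT f.
Proof.
move=> Xc YT2 fc dD Df y _; apply: contrapT => ny.
have cf : closed (range f).
  apply: compact_closed => //; apply: continuous_compact => //.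
  exact: continuous_subspaceT.
have [||z [nz Dz]] := dD (~` range f); first by exists y.
  exact: closed_openC.
by apply: nz; exact: Df.
Qed.

Lemma continuous_bijection_inverse (X Y : topologicalType) (f : X -> Y) g :
  compact [set: X] -> hausdorff_space Y -> continuous f ->
  cancel f g -> cancel g f -> continuous g.
Proof.
move=> Xc YT2 fc fg gf; apply/continuous_closedP => C cC.
have -> : g @^-1` C = f @` C.
  apply/seteqP; split=> [y Cy|_ [x Cx <-]]; last by rewrite /= fg.
  by exists (g y).
apply: compact_closed => //; apply: continuous_compact.
  exact: continuous_subspaceT.
exact: subclosed_compact Xc _.
Qed.

Lemma ultra_cvg (T : Type) (X : topologicalType) (U : set_system T)
    (UU : UltraFilter U) (A : set X) (f : T -> X) :
  compact A -> (forall t, A (f t)) -> exists2 l, A l & f @ U --> l.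
Proof.
move=> Ac Af; have [|l [Al fl]] := Ac (f @ U); first exact: (@filterE _ U _ _ Af).
exists l => // V lV.
have [//|nV] := in_ultra_setVsetC (f @^-1` V) UU.
by have [x [/= nVx Vx]] := fl (~` V) V nV lV.
Qed.

Section Approximation.
Local Open Scope ring_scope.
Variables (R : realType) (X : topologicalType) (T : Type).
Implicit Types (Phi : T -> X -> R) (h : X -> R).

(** Membership in the pointwise closure, spelled out by basic neighbourhoods. The index type is
    free, so that subfamilies of translates can be considered. *)
Definition approximable Phi h : Prop :=
  forall (s : seq X) (d : R), 0 < d ->
  exists t, forall x, x \in s -> `|Phi t x - h x| < d.

Lemma closure_approximable Phi h :
  closure (range (Phi : T -> {ptws X -> R})) (h : {ptws X -> R}) <->
  approximable Phi h.
Proof.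
split=> [Ph s d d0|Ph].
  have nb x : nbhs (h : {ptws X -> R})
      [set k : {ptws X -> R} | `|k x - h x| < d].
    have ev : (fun k : X -> R => k x) @ nbhs (h : {ptws X -> R}) --> h x.
      by apply/pointwise_cvgP: x; exact: cvg_id.
    have -> : [set k : {ptws X -> R} | `|k x - h x| < d] =
        (fun k : X -> R => k x) @^-1` ball (h x) d.
      by apply/funext => k /=; rewrite -ball_normE /= distrC.
    exact: ev _ (nbhsx_ballx (h x) d d0).
  have {}nb : nbhs (h : {ptws X -> R})
      [set k : {ptws X -> R} | forall x, x \in s -> `|k x - h x| < d].
    have FF := nbhs_filter (h : {ptws X -> R}).
    elim: s => [|x s IH]; first exact: (@filterE _ _ FF).
    apply: (@filterS2 _ _ FF _ _ _ _ (nb x) IH) => k kx ks y.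
    by rewrite inE => /predU1P[->|/ks].
  by have [_ [[t _ <-] tP]] := Ph _ nb; exists t.
move=> B hB.
pose b (p : seq X * R) : set (X -> R) := [set k |
  range (Phi : T -> {ptws X -> R}) k /\ forall x, x \in p.1 -> `|k x - h x| < p.2].
pose F := filter_from [set p : seq X * R | 0 < p.2] b.
have FF : ProperFilter F.
  apply: filter_from_proper; last first.
    move=> [s d] /= d0; have [t tP] := Ph s d d0.
    by exists (Phi t); split=> //; exists t.
  apply: filter_from_filter; first by exists ([::], 1) => /=.
  move=> [s d] [s' d'] /= d0 d0'; exists (s ++ s', Num.min d d').
    by rewrite /= lt_min d0.
  move=> k [rk kP]; split; split=> //= x xs.
    by have := kP x; rewrite mem_cat xs lt_min => /(_ isT)/andP[].
  by have := kP x; rewrite mem_cat xs orbT lt_min => /(_ isT)/andP[].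
have Fh : {ptws, F --> h}.
  apply/pointwise_cvgP => x; apply/cvgrPdist_lt => e e0.
  exists ([:: x], e) => //= k [_ /(_ x)]; rewrite mem_head distrC; exact.
have [p p0 pB] := Fh _ hB.
have [k kp] : b p !=set0 by apply: (@filter_ex _ F); exists p.
by exists k; split; [case: kp|exact: pB].
Qed.

(* If h were discontinuous, then its discontinuity would already be visible on
   the dense set J(T'), and sequences with distinct iterated limits could be
   chosen alternately. *)
Lemma approximable_continuous (T' : Type) (Phi : T -> X -> R) (J : T' -> X) h :
  dense (range J) -> (forall t, continuous (Phi t)) ->
  (forall eps : R, 0 < eps -> ~ exists (a : nat -> T') (b : nat -> T),
    forall i j, (i < j)%N ->
      eps <= `|Phi (b j) (J (a i)) - Phi (b i) (J (a j))|) ->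
  approximable Phi h -> continuous h.
Proof.
move=> dJ Pc stab Ph.
(* If [h] along [J] is close to [h x] near every [x], then [h] is continuous: two nearby points are
   compared through a common point of the dense set. *)
have [C|] := pselect (forall x (e : R), 0 < e -> exists2 U, nbhs x U &
    forall t, U (J t) -> `|h (J t) - h x| < e).
  move=> x; apply/cvgrPdist_lt => /= e e0; have e2 : 0 < e / 2 by rewrite divr_gt0.
  have [U xU UP] := C x _ e2.
  apply: filterS (nbhs_interior xU) => y yU.
  have [V yV VP] := C y _ e2.
  have yUV : nbhs y (U `&` V) by apply: filterI.
  have [||z [/interior_subset[Ut Vt] [t _ tE]]] := dJ (U `&` V)°.
  - by exists y; exact: nbhs_singleton (nbhs_interior yUV).
  - exact: open_interior.
  rewrite -tE in Ut Vt; have := UP _ Ut; have := VP _ Vt.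
  have := ler_distD (h (J t)) (h x) (h y); rewrite (distrC (h x) (h (J t))); lra.
move=> /existsNP[x /existsNP[e /not_implyP[e0 /forall2NP xP]]]; exfalso.
have {}xP U : nbhs x U -> exists t, U (J t) /\ e <= `|h (J t) - h x|.
  move=> xU; have [//|/existsNP[t /not_implyP[Ut /negP]]] := xP U.
  by rewrite -leNgt => te; exists t.
have e4 : 0 < e / 4 by apply: divr_gt0.
(* A term pairs a point of [J] where [h] is [e]-far from [h x] with a function of the family that is
   close to [h] at [x]. *)
pose A := ({t | e <= `|h (J t) - h x|} * {t | `|Phi t x - h x| < e / 4})%type.
have near_x (n : nat) (v : nat -> T) : \forall z \near x,
    forall i, (i < n)%N -> `|Phi (v i) z - Phi (v i) x| < e / 4.
  elim: n => [|n IH]; first exact: filterE.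
  have := Pc (v n) x => /cvgrPdist_lt/(_ _ e4) nz.
  apply: filterS2 nz IH => z nz IH i; rewrite ltnS leq_eqVlt => /predU1P[->|].
    by rewrite distrC.
  exact: IH.
have step (s : seq X) n (v : nat -> T) : exists q : A,
    (forall y, y \in s -> `|Phi (sval q.2) y - h y| < e / 4) /\
    forall i, (i < n)%N -> `|Phi (v i) (J (sval q.1)) - Phi (v i) x| < e / 4.
  have [b bP] := Ph (x :: s) _ e4.
  have [a [aP ea]] := xP _ (near_x n v).
  exists (exist _ a ea, exist _ b (bP _ (mem_head _ _))); split=> // y ys.
  by apply: bP; rewrite inE ys orbT.
have [||u uP] := @pairwise_sequence A (fun p q =>
  `|Phi (sval q.2) (J (sval p.1)) - h (J (sval p.1))| < e / 4 /\
  `|Phi (sval p.2) (J (sval q.1)) - Phi (sval p.2) x| < e / 4).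
- move=> n u; have [q [q1 q2]] := step [seq J (sval (u i).1) | i <- iota 0 n] n
    (fun i => sval (u i).2).
  exists q => i ni; split; last exact: q2.
  by apply: q1; apply/mapP; exists i => //; rewrite mem_iota.
- have [b _] := Ph [::] _ e4.
  by have [q _] := step [::] 0%N (fun=> b); split.
(* [Phi (b j) (J (a i))] is close to [h (J (a i))], and [Phi (b i) (J (a j))] is close to
   [Phi (b i) x], hence to [h x]. Three errors of [e / 4] leave a gap of [e / 4]. *)
- apply: (stab _ e4); exists (fun i => sval (u i).1), (fun i => sval (u i).2).
  move=> i j ij; have [u1 u2] := uP i j ij.
  have u3 := svalP (u i).1; have u4 := svalP (u i).2; rewrite /= in u3 u4.
  move: u1 u2 u3 u4.
  rewrite !ltr_norml => /andP[? ?] /andP[? ?] + /andP[? ?].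
  by rewrite !ler_normr => /orP[?|?]; apply/orP; [left|right]; lra.
Qed.
End Approximation.

(** * Weakly almost periodic flows *)

Section UltrafilterLimits.
Local Open Scope ring_scope.

Lemma floor_eq_dist (R : realType) (x y : R) :
  Num.floor x = Num.floor y -> `|x - y| < 1.
Proof.
move=> xy; have /andP[] := real_floor_itv (num_real x).
have /andP[] := real_floor_itv (num_real y); rewrite xy !intrD ltr_norml => ? ? ? ?.
by apply/andP; split; lra.
Qed.

Lemma real_cvg_unique (R : realType) (T : Type) (F : set_system T)
    (FF : ProperFilter F) (f : T -> R) (a b : R) :
  f @ F --> a -> f @ F --> b -> a = b.
Proof. by apply: cvg_unique; exact: Rhausdorff. Qed.

Lemma near_cvg_dist (R : realType) (T : Type) (F : set_system T)
    (FF : Filter F) (f : T -> R) (a e : R) :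
  f @ F --> a -> 0 < e -> \forall t \near F, `|f t - a| < e.
Proof.
move=> /cvgrPdist_lt fa /fa; apply: filterS => t.
by rewrite distrC.
Qed.

Lemma le_addgt0 (R : realType) (x y : R) :
  (forall e : R, 0 < e -> x <= y + e) -> x <= y.
Proof. by move=> xy; apply/ler_addgt0Pr. Qed.

Lemma inv_nat_lt (R : realType) (e : R) : 0 < e -> exists m, m.+1%:R^-1 < e.
Proof.
move=> e0; have [m _ mP] := near_infty_natSinv_lt (PosNum e0).
by exists m; exact: mP (leqnn m).
Qed.

Lemma ultra_approximable (R : realType) (X : topologicalType) (T : Type)
    (Phi : T -> X -> R) (I : Type) (U : set_system I) (UU : UltraFilter U)
    (K : X -> set R) (t : I -> T) :
  (forall x, compact (K x)) -> (forall x i, K x (Phi (t i) x)) ->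
  exists h : X -> R, (forall x, Phi (t i) x @[i --> U] --> h x) /\
    approximable Phi h.
Proof.
move=> Kc PK.
have hP x : exists l : R, Phi (t i) x @[i --> U] --> l.
  by have [l _ lP] := ultra_cvg UU (Kc x) (PK x); exists l.
have [h hh] := choice hP; exists h; split=> // s d d0.
suff /filter_ex[i iP] : U [set i | forall x, x \in s -> `|Phi (t i) x - h x| < d].
  by exists (t i).
elim: s => [|x s IH]; first exact: filterE.
have /cvgrPdist_lt/(_ _ d0) xd := hh x.
apply: filterS2 xd IH => i xd IH y; rewrite inE => /predU1P[->|/IH//].
by rewrite distrC.
Qed.

End UltrafilterLimits.

(** * Countable families with weakly compact closure *)

Section WeaklyCompact.
Local Open Scope ring_scope.
Variables (R : realType) (X : topologicalType) (S : countType).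
Variables (phi : S -> X -> R) (B : R) (x0 : X).
Hypotheses (Xc : compact [set: X]) (phic : forall s, continuous (phi s)).
Hypotheses (phiB : forall s x, `|phi s x| <= B).
Hypothesis (phiw : forall h, approximable phi h -> continuous h).

(** An index prescribes finitely many values of the [phi s], rounded in units of 1/(m+1). One point
    from each nonempty box gives a countable set that is dense for the topology generated by the
    [phi s]. *)
Let J := (seq (S * int) * nat)%type.

Let boxed (i : J) (x : X) :=
  forall p, p \in i.1 -> `|i.2.+1%:R * phi p.1 x - p.2%:~R| <= 1.

Let d_exists : exists d : J -> X,
  forall (x : X) (l : seq S) m, exists i, forall s, s \in l ->
    `|phi s (d i) - phi s x| <= 2 / m.+1%:R.
Proof.
have dP i : exists z, (exists x, boxed i x) -> boxed i z.
  have [[z zi]|nz] := pselect (exists x, boxed i x); first by exists z.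
  by exists x0 => /nz.
have [d dd] := choice dP; exists d => x l m.
pose i : J := ([seq (s, Num.floor (m.+1%:R * phi s x)) | s <- l], m).
exists i => s sl.
have bx : boxed i x.
  move=> _ /mapP[t tl ->] /=.
  have /andP[] := real_floor_itv (num_real (m.+1%:R * phi t x)).
  by rewrite intrD ler_norml => ? ?; apply/andP; split; lra.
have si : (s, Num.floor (m.+1%:R * phi s x)) \in i.1 by apply/mapP; exists s.
have := dd i (ex_intro _ x bx) _ si; have := bx _ si => /=.
have m0 : 0 < m.+1%:R :> R by rewrite ltr0Sn.
have E : `|phi s (d i) - phi s x| * m.+1%:R =
    `|m.+1%:R * phi s (d i) - m.+1%:R * phi s x|.
  by rewrite -mulrBr normrM (ger0_norm (ltW m0)) mulrC.
rewrite ler_pdivlMr// E !ler_norml => /andP[? ?] /andP[? ?].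
by apply/andP; split; lra.
Qed.

Let controls (d : J -> X) (F : seq J) m eta x := forall s s',
  (forall i, i \in F -> `|phi s (d i) - phi s' (d i)| < m.+1%:R^-1) ->
  `|phi s x - phi s' x| <= eta.

(* Otherwise there are two limits of functions phi s which agree on the range
   of d but not at x; both are continuous, hence they agree at every point
   which the functions phi s do not separate from a limit of points of d. *)
Let controlled (d : J -> X) :
  (forall x (l : seq S) m, exists i, forall s, s \in l ->
    `|phi s (d i) - phi s x| <= 2 / m.+1%:R) ->
  forall x (eta : R), 0 < eta -> exists F m, controls d F m eta x.
Proof.
move=> dd x eta eta0; apply: contrapT => nc.
pose b (p : seq J * nat) := [set s : S * S |
  (forall i, i \in p.1 -> `|phi s.1 (d i) - phi s.2 (d i)| < p.2.+1%:R^-1) /\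
  eta < `|phi s.1 x - phi s.2 x|].
have FF : ProperFilter (filter_from setT b).
  apply: filter_from_proper; last first.
    move=> [F m] _; apply: contrapT => nb; apply: nc; exists F, m => s s' ss.
    by rewrite leNgt; apply/negP => ex; apply: nb; exists (s, s').
  apply: filter_from_filter; first by exists ([::], 0%N).
  move=> [F m] [F' m'] _ _; exists (F ++ F', maxn m m') => // s [/= s1 s2].
  split; split=> //= i iF; apply: lt_le_trans (s1 i _) _; rewrite ?mem_cat ?iF ?orbT//.
    by rewrite lef_pV2 ?posrE ?ltr0Sn// ler_nat ltnS leq_maxl.
  by rewrite lef_pV2 ?posrE ?ltr0Sn// ler_nat ltnS leq_maxr.
have [U [UU FU]] := ultraFilterLemma FF.
have PF : ProperFilter U by exact: ultra_proper.
have UF : Filter U by exact: filter_filter.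
have Kc (z : X) : compact `[- B, B]%classic by exact: segment_compact.
have PK s z : `[- B, B]%classic (phi s z).
  by rewrite /= in_itv /= -ler_norml.
have [h [hh /phiw hc]] := ultra_approximable (t := fst) UU Kc (fun z i => PK _ z).
have [h' [hh' /phiw hc']] := ultra_approximable (t := snd) UU Kc (fun z i => PK _ z).
have hd i : h (d i) = h' (d i).
  apply/eqP; rewrite -subr_eq0 -normr_le0; apply: le_addgt0 => e e0.
  rewrite add0r.
  have e3 : 0 < e / 3 by rewrite divr_gt0.
  have [m me] := inv_nat_lt e3.
  have n1 := near_cvg_dist UF (hh (d i)) e3.
  have n2 := near_cvg_dist UF (hh' (d i)) e3.
  have n3 : U (b ([:: i], m)) by apply: FU; exists ([:: i], m).
  have [s [s1 [s2 [/(_ i (mem_head _ _)) s3 _]]]] := filter_ex (filterI n1 (filterI n2 n3)).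
  move: s1 s2 (lt_trans s3 me); rewrite /= !ltr_norml ler_norml => /andP[? ?] /andP[? ?] /andP[? ?].
  by apply/andP; split; lra.
have hx : eta <= `|h x - h' x|.
  apply: le_addgt0 => e e0; have e2 : 0 < e / 2 by rewrite divr_gt0.
  have n1 := near_cvg_dist UF (hh x) e2.
  have n2 := near_cvg_dist UF (hh' x) e2.
  have n3 : U (b ([::], 0%N)) by apply: FU; exists ([::], 0%N).
  have [s [s1 [s2 [_ s3]]]] := filter_ex (filterI n1 (filterI n2 n3)).
  have t1 := ler_distD (h x) (phi s.1 x) (phi s.2 x).
  have t2 := ler_distD (h' x) (h x) (phi s.2 x).
  rewrite /= in s1 s2 s3; rewrite (distrC (h' x)) in t2; lra.
(* An ultrafilter along which the points [d i] look like [x] to every [phi s]. By compactness they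
   have a limit [x']; as [phi s x' = phi s x] for all [s], also [h] and [h'] take the same values at
   [x'] as at [x]. *)
pose c (p : seq S * nat) := [set i | forall s, s \in p.1 ->
  `|phi s (d i) - phi s x| <= 2 / p.2.+1%:R].
have CF : ProperFilter (filter_from setT c).
  apply: filter_from_proper; last by move=> [l m] _; exact: dd x l m.
  apply: filter_from_filter; first by exists ([::], 0%N).
  move=> [F m] [F' m'] _ _; exists (F ++ F', maxn m m') => // i /= iP.
  split=> s sF; apply: le_trans (iP s _) _; rewrite ?mem_cat ?sF ?orbT//.
    by rewrite ler_pM2l// lef_pV2 ?posrE ?ltr0Sn// ler_nat ltnS leq_maxl.
  by rewrite ler_pM2l// lef_pV2 ?posrE ?ltr0Sn// ler_nat ltnS leq_maxr.
have [W [WU CW]] := ultraFilterLemma CF.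
have PW : ProperFilter W by exact: ultra_proper.
have [x' _ x'P] := ultra_cvg WU Xc (fun i => I : [set: X] (d i)).
have phix' s : phi s x' = phi s x.
  apply: (@real_cvg_unique _ _ W PW (phi s \o d)).
    by apply: cvg_comp x'P _; exact: phic.
  apply/cvgrPdist_lt => e e0; have e2 : 0 < e / 2 by rewrite divr_gt0.
  have [m me] := inv_nat_lt e2.
  have : W (c ([:: s], m)) by apply: CW; exists ([:: s], m).
  apply: filterS => i /(_ s (mem_head _ _)) /= si.
  rewrite distrC; apply: le_lt_trans si _; move: me; set r := _^-1; lra.
have hx' : h x' = h x.
  apply: (real_cvg_unique PF (hh x')); move: (hh x).
  by under eq_fun do rewrite -phix'.
have hx'' : h' x' = h' x.
  apply: (real_cvg_unique PF (hh' x')); move: (hh' x).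
  by under eq_fun do rewrite -phix'.
have : h x' = h' x'.
  apply: (@real_cvg_unique _ _ W PW (h \o d)).
    by apply: cvg_comp x'P _; exact: hc.
  have -> : h \o d = h' \o d by apply/funext.
  by apply: cvg_comp x'P _; exact: hc'.
rewrite hx' hx'' => hh0; move: hx; rewrite hh0 subrr normr0.
by rewrite leNgt eta0.
Qed.

(* Let c x record a finite set F and a tolerance which control phi s x up to
   dl / 3, together with the values, rounded to dl / 3, of phi s x for one s in
   each of the finitely many classes of nearly equal behaviour on F. *)
Lemma weakly_compact_separable (dl : R) : 0 < dl ->
  exists c : X -> nat, forall x y, c x = c y ->
    forall s, `|phi s x - phi s y| <= dl.
Proof.
move=> dl0; have [d dd] := d_exists.
have e0 : 0 < dl / 3 by rewrite divr_gt0.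
have ctl x : exists p : seq J * nat, controls d p.1 p.2 (dl / 3) x.
  by have [F [m Fm]] := controlled dd x e0; exists (F, m).
have [p pP] := choice ctl.
(* Adding [B] makes the scaled values nonnegative and bounded, so the behaviours on a finite set
   fall into finitely many cells. *)
pose code (m : nat) (s : S) (i : J) : nat :=
  absz (Num.floor (m.+1%:R * (phi s (d i) + B))).
pose N (m : nat) : nat := absz (Num.floor (m.+1%:R * (B + B))).
pose cells (q : seq J * nat) : finType := {ffun 'I_(size q.1) -> 'I_(N q.2).+1}.
pose cell (q : seq J * nat) (s : S) : cells q :=
  [ffun k => inord (code q.2 s (tnth (in_tuple q.1) k))].
have m0 m : 0 < m.+1%:R :> R by rewrite ltr0Sn.
have phiB2 s x : 0 <= phi s x + B <= B + B.
  by have := phiB s x; rewrite ler_norml => /andP[? ?]; apply/andP; split; lra.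
have codeN m s i : (code m s i < (N m).+1)%N.
  have /andP[p1 p2] := phiB2 s (d i).
  rewrite ltnS -lez_nat !gez0_abs ?floor_ge0 ?mulr_ge0 ?(le_trans p1 p2)//.
  by apply: le_floor; rewrite ler_pM2l.
have cell_close q s s' : cell q s = cell q s' ->
    forall i, i \in q.1 -> `|phi s (d i) - phi s' (d i)| < q.2.+1%:R^-1.
  move=> ss i /(tnthP (in_tuple q.1))[k ->].
  set j := tnth _ _.
  have /(congr1 val) : cell q s k = cell q s' k by rewrite ss.
  rewrite !ffunE /= !inordK ?codeN// => /(congr1 Posz).
  rewrite !gez0_abs ?floor_ge0 ?mulr_ge0//.
  all: try by [case/andP: (phiB2 s (d j))|case/andP: (phiB2 s' (d j))].
  move=> /floor_eq_dist; rewrite -mulrBr normrM (ger0_norm (ltW (m0 _))).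
  rewrite -[_^-1]mul1r ltr_pdivlMr// mulrC.
  by congr (_ < _); congr (`| _ | * _); ring.
pose rep (q : seq J * nat) (c : cells q) : option S :=
  if pselect (exists s, cell q s = c) is left e then Some (sval (cid e)) else None.
pose dat q x : seq int := [seq (if rep q c is Some s then
  Num.floor (3 / dl * phi s x) else 0) | c <- enum (cells q)].
exists (fun x => choice.pickle (p x, dat (p x) x)) => x y.
move=> /(pcan_inj choice.pickleK)[pxy]; rewrite -pxy => dxy s.
have [s0 s0E s0P] : exists2 s0, rep (p x) (cell (p x) s) = Some s0 &
    cell (p x) s0 = cell (p x) s.
  rewrite /rep; case: pselect => [e|[]]; last by exists s.
  by case: cid => s0 /= ?; exists s0.
have := pP y; rewrite -pxy => /(_ _ _ (cell_close _ _ _ s0P)) cy.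
have := pP x => /(_ _ _ (cell_close _ _ _ s0P)) cx.
have : `|3 / dl * phi s0 x - 3 / dl * phi s0 y| < 1.
  apply: floor_eq_dist; move/eq_in_map: dxy => /(_ (cell (p x) s)).
  by rewrite mem_enum s0E => ->.
rewrite -mulrBr normrM (@ger0_norm _ (3 / dl)); last by rewrite divr_ge0// ltW.
rewrite mulrC -ltr_pdivlMr ?divr_gt0// div1r invf_div => c0.
have t1 := ler_distD (phi s0 x) (phi s x) (phi s y).
have t2 := ler_distD (phi s0 y) (phi s0 x) (phi s y).
rewrite (distrC (phi s x) (phi s0 x)) in t1; lra.
Qed.

End WeaklyCompact.

Section WapFlows.
Local Open Scope ring_scope.
Variables (R : realType) (G : groupType) (X : topologicalType).
Variables (act : G -> X -> X).
Hypothesis flowX : is_flow act.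

Let Xne : [set: X] !=set0. Proof. by case: flowX. Qed.
Let Xc : compact [set: X]. Proof. by case: flowX. Qed.
Let XT2 : hausdorff_space X. Proof. by case: flowX. Qed.
Let act1 x : act 1%g x = x. Proof. by case: flowX => _ _ _ []. Qed.
Let actM g h x : act (g * h)%g x = act g (act h x).
Proof. by case: flowX => _ _ _ []. Qed.
Let actc g : continuous (act g). Proof. by case: flowX => _ _ _ []. Qed.

Lemma wapP : wap R act <-> forall f : X -> R, continuous f ->
  forall h, approximable (fun g x => f (act g x)) h -> continuous h.
Proof.
split=> w f fc h fh; apply: w (fc) _ _; exact/closure_approximable.
Qed.

Lemma continuous_translate (f : X -> R) g : continuous f -> continuous (f \o act g).
Proof. by move=> fc x; apply: continuous_comp; [exact: actc|exact: fc]. Qed.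

(** Let [h] be a limit of the functions [f (act (b i) _)] and [y] a limit of the points
    [act (a i) x0]. By wap [h] is continuous, so both iterated limits equal [h y]. *)
Lemma wap_stable (f : X -> R) (x0 : X) : wap R act -> continuous f ->
  forall eps : R, 0 < eps -> ~ exists a b : nat -> G, forall i j, (i < j)%N ->
    eps <= `|f (act (b j * a i)%g x0) - f (act (b i * a j)%g x0)|.
Proof.
move=> /wapP w fc eps e0 [a [b ab]].
have [U [UU FU]] := ultraFilterLemma eventually_filter.
have PU : ProperFilter U by exact: ultra_proper.
have UF : Filter U by exact: filter_filter.
have fK : compact (range f).
  by apply: continuous_compact => //; exact: continuous_subspaceT.
have [h [hh hf]] := ultra_approximable (R := R)
  (Phi := fun g x => f (act g x)) (t := b) UU (fun=> fK) (fun x i => imageT f _).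
have hc := w _ fc _ hf.
have [y _ yP] := ultra_cvg UU Xc (fun i => I : [set: X] (act (a i) x0)).
have e4 : 0 < eps / 4 by rewrite divr_gt0.
have n1 : \forall i \near U, `|h (act (a i) x0) - h y| < eps / 4.
  by apply: near_cvg_dist e4; apply: (cvg_comp _ _ yP); exact: hc.
have n2 := near_cvg_dist UF (hh y) e4.
have [i [i1 i2]] := filter_ex (filterI n1 n2).
have n3 := near_cvg_dist UF (hh (act (a i) x0)) e4.
have fy : f (act (b i) (act (a j) x0)) @[j --> U] --> f (act (b i) y).
  apply: (cvg_comp (fun j => act (a j) x0) (f \o act (b i)) yP).
  exact: continuous_translate.
have n4 := near_cvg_dist UF fy e4.
have n5 : U [set j | (i < j)%N] by apply: FU; exists i.+1.
have [j [j3 [j4 j5]]] := filter_ex (filterI n3 (filterI n4 n5)).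
have := ab i j j5; rewrite !actM.
have t1 := ler_distD (h (act (a i) x0)) (f (act (b j) (act (a i) x0))) (f (act (b i) (act (a j) x0))).
have t2 := ler_distD (h y) (h (act (a i) x0)) (f (act (b i) (act (a j) x0))).
have t3 := ler_distD (f (act (b i) y)) (h y) (f (act (b i) (act (a j) x0))).
move: i1 i2 j3 j4; rewrite /=.
rewrite (distrC (f (act (b i) y)) (h y)) (distrC (f (act (b i) (act (a j) x0))) (f (act (b i) y))).
lra.
Qed.

(** * Equicontinuity of minimal flows *)

Hypotheses (minX : minimal act) (wapX : wap R act).

Section Tree.
Variables (f : X -> R) (eps : R).
Hypotheses (fc : continuous f) (eps0 : 0 < eps).
Hypothesis wide : forall U : set X, open U -> U !=set0 ->
  exists x y g, [/\ U x, U y & eps < `|f (act g x) - f (act g y)|].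

Let O := {U : set X | open U /\ U !=set0}.

(** On each child [f \o act g] varies by less than [eps / 3] around a chosen point, and the two
    chosen values differ by more than [eps]. Closures are controlled so that compactness yields a
    point on every branch. *)
Let split_open (U : O) : exists q : G * (bool -> O),
  (forall b, closure (sval (q.2 b)) `<=` sval U) /\
  forall x y, closure (sval (q.2 true)) x -> closure (sval (q.2 false)) y ->
    eps / 3 <= `|f (act q.1 x) - f (act q.1 y)|.
Proof.
case: U => U [oU U0] /=; have [x [y [g [Ux Uy xy]]]] := wide oU U0.
have sub z : U z -> exists V : O, closure (sval V) `<=` U /\
    forall t, closure (sval V) t -> `|f (act g t) - f (act g z)| < eps / 3.
  move=> Uz; have e3 : 0 < eps / 3 by rewrite divr_gt0.
  have zU : nbhs z U by exact: open_nbhs_nbhs.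
  have gc : continuous (f \o act g) by exact: continuous_translate.
  have nz := near_cvg_dist (nbhs_filter z) (gc z) e3.
  have [V [oV Vz VU]] := compact_regular_open XT2 Xc (filterI zU nz).
  have V0 : open V /\ V !=set0 by split=> //; exists z.
  by exists (exist _ V V0); split=> t /VU[].
have [V [VU Vx]] := sub _ Ux; have [W [WU Wy]] := sub _ Uy.
exists (g, fun b => if b then V else W); split=> [[]//|t u /Vx tx /Wy uy /=].
have t1 := ler_distD (f (act g t)) (f (act g x)) (f (act g y)).
have t2 := ler_distD (f (act g u)) (f (act g t)) (f (act g y)).
rewrite (distrC (f (act g x)) (f (act g t))) in t1; lra.
Qed.

(** The group elements at the nodes form a countable family, so [weakly_compact_separable] applies
    with tolerance [eps / 6]. Two branches are [eps / 3] apart for the function at the node where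
    they split, so the set of all branches would inject into [nat]. *)
Lemma no_wide_tree : False.
Proof.
have [st stP] := choice split_open.
have OT : open [set: X] /\ [set: X] !=set0 by split; first exact: openT.
pose V := fix V (s : seq bool) : O :=
  if s is b :: s' then (st (V s')).2 b else exist _ setT OT.
(* The latest choice is the head of the list, so that [V] refines by recursion. *)
pose path (sg : nat -> bool) := fix path n := if n is m.+1 then sg m :: path m else [::].
have Vmono sg m n : (m <= n)%N -> sval (V (path sg n)) `<=` sval (V (path sg m)).
  move=> /subnK <-; elim: (n - m)%N => //= k IH.
  apply: subset_trans IH => z Vz.
  exact: (stP (V (path sg (k + m)%N))).1 _ _ (subset_closure Vz).
have yP sg : exists y, forall n, closure (sval (V (path sg n))) y.
  have zP n : exists z, sval (V (path sg n)) z by case: (svalP (V (path sg n))).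
  have [z zV] := choice zP.
  have [|y [_ yz]] := Xc (F := z @ \oo); first exact: filterE.
  exists y => n W yW; apply: yz => //.
  by exists n => // k /= nk; exact: (Vmono sg _ _ nk).
have [y yV] := choice yP.
have fK : compact (range f).
  by apply: continuous_compact => //; exact: continuous_subspaceT.
have [B fB] : exists B, forall x, `|f x| <= B.
  have /compact_bounded[M [_ MP]] := fK.
  by exists (M + 1) => x; apply: MP; rewrite ?ltrDl//; exists x.
pose phi s x := f (act (st (V s)).1 x).
have [x0 _] := Xne.
have wphi h : approximable phi h -> continuous h.
  move=> ah; apply: (wapP.1 wapX f fc) => s d d0.
  by have [t tP] := ah s d d0; exists (st (V t)).1.
have e6 : 0 < eps / 6 by rewrite divr_gt0.
have phic s : continuous (phi s) by exact: continuous_translate.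
have [c cP] := weakly_compact_separable x0 Xc phic (fun s x => fB _) wphi e6.
have inj : injective (c \o y).
  move=> sg tu /cP close; apply: contrapT => st'.
  have [n [En dn]] : exists n, path sg n = path tu n /\ sg n <> tu n.
    apply: contrapT => nn; apply: st'; apply/funext => n.
    suff : path sg n.+1 = path tu n.+1 by case.
    elim: n => [|n IH] /=.
      by congr (_ :: _); apply: contrapT => ?; apply: nn; exists 0%N.
    move: (IH) => /= ->; congr (_ :: _); apply: contrapT => ?; apply: nn.
    by exists n.+1.
  have := yV sg n.+1; have := yV tu n.+1; have := close (path sg n).
  rewrite /= -En /phi; move: (V (path sg n)) => W.
  case: (sg n) (tu n) dn => -[]// _ cl Wt Ws.
    by have := (stP W).2 _ _ Ws Wt; lra.
  by have := (stP W).2 _ _ Wt Ws; rewrite distrC; lra.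
(* Cantor's diagonal sequence for the injection [c \o y]. *)
pose dg n := if pselect (exists sg, c (y sg) = n) is left e then ~~ sval (cid e) n else false.
have : dg (c (y dg)) = ~~ dg (c (y dg)).
  rewrite {1}/dg; case: pselect => [e|[]]; last by exists dg.
  by case: cid => sg /= /inj E; rewrite E.
by case: (dg _).
Qed.

End Tree.

(* The pseudometric sup_g |f(gx) - f(gy)| is invariant, so by minimality it is
   enough to find one nonempty open set of small diameter.  If there were none,
   a binary tree of open sets would give 2^aleph0 uniformly separated points. *)
Theorem minimal_wap_equicontinuous (f : X -> R) (eps : R) (x : X) :
  continuous f -> 0 < eps ->
  \forall y \near x, forall g, `|f (act g y) - f (act g x)| <= eps.
Proof.
move=> fc e0.
have [U [oU U0 UP]] : exists U : set X, [/\ open U, U !=set0 & forall y z g,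
    U y -> U z -> `|f (act g y) - f (act g z)| <= eps].
  apply: contrapT => nU; apply: (no_wide_tree fc e0) => U oU U0.
  apply: contrapT => nw; apply: nU; exists U; split=> // y z g Uy Uz.
  by rewrite leNgt; apply/negP => yz; apply: nw; exists y, z, g.
have [z [Uz [g _ gz]]] := (minX x : dense _) U U0 oU.
have Ugx : U (act g x) by rewrite gz.
have nx : nbhs x (act g @^-1` U).
  by apply: actc; exact: open_nbhs_nbhs.
apply: filterS nx => y /= Uy k.
have E t : act k t = act (k * g^-1)%g (act g t) by rewrite -actM mulgVK.
by rewrite !E; apply: UP.
Qed.

End WapFlows.

(** * Formulas and the type space of a definable group *)

Lemma finite_set_In (T : Type) (A : set T) :
  finite_set A -> exists l : seq T, forall x, A x <-> List.In x l.
Proof.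
elim/Pchoice: T => T in A *.
move=> /finite_seqP[l ->]; exists l => x /=; elim: l => //= y l IH.
rewrite inE; split=> [/predU1P[->|/IH]|[->|/IH xl]]; [by left|by right| |].
  by rewrite eqxx.
by apply/orP; right.
Qed.

Lemma filter_In (T I : Type) (F : set_system T) (FF : Filter F)
    (l : seq I) (B : I -> set T) :
  (forall i, List.In i l -> F (B i)) -> F [set x | forall i, List.In i l -> B i x].
Proof.
elim: l => [|i l IH] lB; first by apply: filterE => x i [].
have Bi := lB i (or_introl erefl); have Bl := IH (fun j jl => lB j (or_intror jl)).
by apply: filterS (filterI Bi Bl) => x [Bx lx] j [<-//|/lx].
Qed.

Section Relabel.
Variables (L : language) (A B : Type) (h : A -> B).

Fixpoint term_relabel n (t : term L A n) : term L B n :=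
  match t with
  | TVar i => TVar i
  | TPar a => TPar (h a)
  | TApp f args => TApp (fun i => term_relabel (args i))
  end.

(** Renaming constants allows formulas over M to be combined with formulas over further
    parameters. *)
Fixpoint relabel n (p : formula L A n) : formula L B n :=
  match p with
  | FEq _ t u => FEq (term_relabel t) (term_relabel u)
  | FRel _ r args => FRel (fun i => term_relabel (args i))
  | FNot _ p => FNot (relabel p)
  | FAnd _ p q => FAnd (relabel p) (relabel q)
  | FEx _ p => FEx (relabel p)
  end.

Variables (N : structure L) (par : B -> N).

Lemma teval_relabel n (t : term L A n) v :
  teval par v (term_relabel t) = teval (par \o h) v t.
Proof.
by elim: t => //= f args IH; congr fint; apply/funext => i; exact: IH.
Qed.

Lemma sat_relabel n (p : formula L A n) v :
  sat par (relabel p) v <-> sat (par \o h) p v.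
Proof.
elim: p v => {n} /= [n t u|n r args|n p IH|n p IHp q IHq|n p IH] v.
- by rewrite !teval_relabel.
- suff -> : (fun i => teval par v (term_relabel (args i))) =
    (fun i => teval (par \o h) v (args i)) by [].
  by apply/funext => i; rewrite teval_relabel.
- by rewrite IH.
- by rewrite IHp IHq.
- by split=> -[a ?]; exists a; apply/IH.
Qed.

End Relabel.
Arguments relabel {L A B} h {n} p.

Section GroupFormulas.
Variables (L : language) (A : Type) (n : nat).
Variables (phi : formula L A n) (mu : formula L A (n + (n + n))).
Implicit Types (psi chi : formula L A n).

(** [phi] serves as the empty conjunction, since it holds at every group element. *)
Definition fall (l : seq (formula L A n)) : formula L A n := foldr (@FAnd L A n) phi l.

(* chi(y x) for some y satisfying psi *)
Definition fshift psi chi : formula L A n :=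
  let y i : term L A (n + n + n) := TVar (lshift n (lshift n i)) in
  let w i : term L A (n + n + n) := TVar (lshift n (rshift n i)) in
  let x i : term L A (n + n + n) := TVar (rshift (n + n) i) in
  exs (FAnd (FAnd (subst phi y) (subst phi w))
    (FAnd (subst mu (tcat y (tcat x w))) (FAnd (subst psi y) (subst chi w)))).

(** The identity is the only solution of x x = x, so it is definable without constants. *)
Definition fone : formula L A n :=
  let x i : term L A n := TVar i in subst mu (tcat x (tcat x x)).

Definition finv psi : formula L A n := fshift psi fone.

Definition fpoint (a : 'I_n -> A) : formula L A n :=
  foldr (@FAnd L A n) phi [seq FEq (TVar i) (TPar (a i)) | i <- enum 'I_n].

Variables (N : structure L) (par : A -> N) (G : definable_group par phi mu).

Lemma sat_phi (x : G) : sat par phi (gemb x).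
Proof. by apply/(gemb_dom G); exists x. Qed.

Lemma sat_fall (l : seq (formula L A n)) (x : G) :
  sat par (fall l) (gemb x) <-> List.Forall (fun p => sat par p (gemb x)) l.
Proof.
elim: l => [|p l IH] /=; first by split=> _; [constructor|exact: sat_phi].
split=> [[xp /IH xl]|]; first by constructor.
by move=> xl; inversion xl; split=> //; apply/IH.
Qed.

Lemma sat_fshift psi chi (x : G) : sat par (fshift psi chi) (gemb x) <->
  exists y : G, sat par psi (gemb y) /\ sat par chi (gemb (y * x)%g).
Proof.
pose v (w : 'I_(n + n) -> N) := tcat w (gemb x).
have yE w : (fun i => teval par (v w)
    (TVar (lshift n (lshift n i)) : term L A (n + n + n))) = w \o @lshift n n.
  by apply/funext => i /=; rewrite /v /tcat (unsplitK (inl (lshift n i))).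
have wE w : (fun i => teval par (v w)
    (TVar (lshift n (rshift n i)) : term L A (n + n + n))) = w \o @rshift n n.
  by apply/funext => i /=; rewrite /v /tcat (unsplitK (inl (rshift n i))).
have mE w : (fun i => teval par (v w)
    (tcat (fun i => TVar (lshift n (lshift n i)) : term L A (n + n + n))
      (tcat (fun i => TVar (rshift (n + n) i) : term L A (n + n + n))
        (fun i => TVar (lshift n (rshift n i)) : term L A (n + n + n))) i)) =
    tcat (w \o @lshift n n) (tcat (gemb x) (w \o @rshift n n)).
  apply/funext => i; rewrite /tcat; case: (fintype.split i) => /= k.
    by rewrite /v /tcat (unsplitK (inl (lshift n k))).
  case: (fintype.split k) => /= l.
    by rewrite /v /tcat (unsplitK (inr l)).
  by rewrite /v /tcat (unsplitK (inl (rshift n l))).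
rewrite /fshift sat_exs; split=> [[w /=]|[y [py cy]]].
  rewrite -/(v w) !sat_subst !yE !wE mE => -[[/(gemb_dom G)[y yw] /(gemb_dom G)[z zw]]].
  rewrite -yw -zw => -[/gemb_mul xyz [py cz]].
  by exists y; rewrite xyz.
exists (tcat (gemb y) (gemb (y * x)%g)) => /=.
rewrite -/(v _) !sat_subst !yE !wE mE.
have -> : tcat (gemb y) (gemb (y * x)%g) \o @lshift n n = gemb y.
  by apply/funext => i /=; rewrite /tcat (unsplitK (inl i)).
have -> : tcat (gemb y) (gemb (y * x)%g) \o @rshift n n = gemb (y * x)%g.
  by apply/funext => i /=; rewrite /tcat (unsplitK (inr i)).
by split; [split; exact: sat_phi|split=> //; exact/gemb_mul].
Qed.

Lemma sat_fone (x : G) : sat par fone (gemb x) <-> x = 1%g.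
Proof.
rewrite /fone sat_subst.
have -> : (fun i => teval par (gemb x) (tcat (fun i => TVar i : term L A n)
    (tcat (fun i => TVar i : term L A n) (fun i => TVar i : term L A n)) i)) =
    tcat (gemb x) (tcat (gemb x) (gemb x)).
  apply/funext => i; rewrite /tcat; case: (fintype.split i) => //= k.
  by case: (fintype.split k).
split=> [/gemb_mul xx|->]; last by apply/gemb_mul; rewrite mulg1.
by apply: (mulgI x); rewrite xx mulg1.
Qed.

Lemma sat_finv psi (x : G) :
  sat par (finv psi) (gemb x) <-> sat par psi (gemb (x^-1)%g).
Proof.
rewrite /finv sat_fshift; split=> [[y [py /sat_fone yx]]|px].
  suff -> : (x^-1)%g = y by [].
  by apply: (mulIg x); rewrite mulVg yx.
by exists (x^-1)%g; split=> //; apply/sat_fone; rewrite mulVg.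
Qed.

Lemma sat_fpoint (a : 'I_n -> A) (g x : G) : gemb g = par \o a ->
  sat par (fpoint a) (gemb x) <-> x = g.
Proof.
move=> ga; have E : sat par (fpoint a) (gemb x) <->
    {in enum 'I_n, gemb x =1 par \o a}.
  rewrite /fpoint; elim: (enum 'I_n) => [|i l IH] /=.
    by split=> // _; exact: sat_phi.
  rewrite IH; split=> [[xi xl] j|xl]; first by rewrite inE => /predU1P[->|/xl].
  split; first exact: xl (mem_head _ _).
  by move=> j jl; apply: xl; rewrite inE jl orbT.
rewrite E; split=> [xa|-> i _]; last by rewrite ga.
by apply: gemb_inj; rewrite ga; apply/funext => i; apply: xa; rewrite mem_enum.
Qed.

Lemma sat_fshift_point (a : 'I_n -> A) (g x : G) chi : gemb g = par \o a ->
  sat par (fshift (fpoint a) chi) (gemb x) <-> sat par chi (gemb (g * x)%g).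
Proof.
move=> ga; rewrite sat_fshift; split=> [[y [/(sat_fpoint _ ga)-> //]]|cx].
by exists g; split=> //; apply/(sat_fpoint _ ga).
Qed.

(** Since x g = (g^-1 x^-1)^-1, a left shift between two inversions is a right shift. *)
Lemma sat_rshift_point (a : 'I_n -> A) (g x : G) chi :
  gemb (g^-1)%g = par \o a ->
  sat par (finv (fshift (fpoint a) (finv chi))) (gemb x) <->
  sat par chi (gemb (x * g)%g).
Proof.
by move=> ga; rewrite sat_finv (sat_fshift_point _ _ ga) sat_finv invgM !invgK.
Qed.

End GroupFormulas.

Section TypeSpace.
Variables (L : language) (M : structure L) (n : nat).
Variables (phi : formula L M n) (mu : formula L M (n + (n + n))).
Variable G : definable_group id phi mu.
Implicit Types (p q : type_space phi) (psi chi : formula L M n) (g x : G).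

Lemma type_realize1 p psi : sval p psi -> exists x, sat id psi (gemb x).
Proof.
move=> pp; have [||x xP] := @type_realize _ _ _ _ _ G p [set psi].
- exact: finite_set1.
- by move=> _ ->.
- by exists x; exact: xP.
Qed.

Lemma type_realize2 p psi chi : sval p psi -> sval p chi ->
  exists x, sat id psi (gemb x) /\ sat id chi (gemb x).
Proof.
move=> pp pc; have [||x xP] := @type_realize _ _ _ _ _ G p [set psi; chi].
- by rewrite finite_setU; split; exact: finite_set1.
- by move=> _ [->|->].
- by exists x; split; apply: xP; [left|right].
Qed.

Lemma type_mono p psi chi :
  (forall x, sat id psi (gemb x) -> sat id chi (gemb x)) ->
  sval p psi -> sval p chi.
Proof.
move=> pc pp; have [//|nc] := (svalP p).1.2 chi.
by have [x [/pc ? /= []]] := type_realize2 pp nc.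
Qed.

Lemma type_not p psi : sval p (FNot psi) <-> ~ sval p psi.
Proof.
split=> [np pp|np]; first by have [x [? []]] := type_realize2 pp np.
by have [|] := (svalP p).1.2 psi.
Qed.

Lemma type_and p psi chi : sval p (FAnd psi chi) <-> sval p psi /\ sval p chi.
Proof.
split=> [pc|[pp pc]]; first by split; apply: type_mono pc => x [].
apply: contrapT => /type_not nc.
have [||x xP] := @type_realize _ _ _ _ _ G p [set psi; chi; FNot (FAnd psi chi)].
- by rewrite !finite_setU; split; [split|]; exact: finite_set1.
- by move=> _ [[->|->]|->].
- have /= := xP _ (or_intror erefl); apply; split; apply: xP; left; by [left|right].
Qed.

Lemma nbhs_typeP p (U : set (type_space phi)) :
  nbhs p U <-> exists psi, sval p psi /\ type_basic psi `<=` U.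
Proof.
split=> [|[psi [pp pU]]]; last first.
  rewrite nbhsE /=; exists (type_basic psi) => //.
  by split=> //; exact: type_basic_open.
rewrite nbhsE => -[V [[D DfI <-] [W DW Wp]] VU].
have [F FB WE] := DfI W DW.
suff [psi [pp pW]] : exists psi, sval p psi /\ type_basic psi `<=` W.
  by exists psi; split=> // q /pW Wq; apply: VU; exists W.
subst W; rewrite bigcap_fset in Wp *; rewrite !big_seq in Wp *.
move: Wp; elim/big_rec: _ => [_|V' W' VF IH [Vp Wp]].
  by exists phi; split=> //; exact: (svalP p).2.
have [psi [pp pW]] := IH Wp.
have /set_mem[chi _ chiE] := FB _ VF; subst V'.
exists (FAnd chi psi); split; first by apply/type_and.
by move=> q /type_and[cq /pW].
Qed.

Lemma type_basic_closed psi : closed (type_basic psi : set (type_space phi)).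
Proof.
rewrite -[type_basic psi]setCK; apply: open_closedC.
suff -> : ~` (type_basic psi : set (type_space phi)) = type_basic (FNot psi).
  exact: type_basic_open.
by apply/seteqP; split=> p /type_not.
Qed.

Lemma closed_typeP (C : set (type_space phi)) p : closed C -> ~ C p ->
  exists psi, C `<=` type_basic psi /\ ~ sval p psi.
Proof.
move=> cC nCp; have nb : nbhs p (~` C).
  by apply: open_nbhs_nbhs; split=> //; exact: closed_openC.
have [psi [pp pC]] := (nbhs_typeP _ _).1 nb.
exists (FNot psi); split; last by move/type_not.
by move=> q Cq; apply/type_not => /pC.
Qed.

Lemma type_space_compact : compact [set: type_space phi].
Proof.
rewrite compact_ultra => U UU _.
pose P : set (formula L M n) := [set psi | U (type_basic psi)].
have PU : ProperFilter U by exact: ultra_proper.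
have UF : Filter U by exact: filter_filter.
have Pfin Psi : finite_set Psi -> Psi `<=` P ->
    exists p, forall psi, Psi psi -> sval p psi.
  move=> /finite_set_In[l lE] FP.
  have [|p pl] := filter_ex (filter_In (l := l) (B := @type_basic L M n phi) UF _).
    by move=> psi /lE/FP.
  by exists p => psi /lE/pl.
have PT : complete_type id P /\ P phi.
  split; last by apply: filterE => p; exact: (svalP p).2.
  split=> [Psi Pf /(Pfin _ Pf)[p pP]|psi].
    by have [x xP] := type_realize G Pf pP; exists (gemb x).
  have [|nP] := in_ultra_setVsetC (type_basic psi) UU; first by left.
  by right; apply: filterS nP => p; move/type_not.
exists (exist _ P PT); split=> // V /nbhs_typeP[psi [/= Ppsi pV]].
exact: filterS pV _.
Qed.

Lemma type_space_hausdorff : hausdorff_space (type_space phi).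
Proof.
move=> p q pq; apply: type_ext => psi; split=> pp; apply: contrapT.
  move=> /type_not qn.
  have [||r [rp rn]] := pq (type_basic psi) (type_basic (FNot psi)).
  - by apply/nbhs_typeP; exists psi; split.
  - by apply/nbhs_typeP; exists (FNot psi); split.
  - exact: (type_not _ _).1 rn rp.
move=> /type_not qn.
have [||r [rp rn]] := pq (type_basic (FNot psi)) (type_basic psi).
- by apply/nbhs_typeP; exists (FNot psi); split.
- by apply/nbhs_typeP; exists psi; split.
- exact: (type_not _ _).1 rp rn.
Qed.

Lemma dense_tp : dense (range (@tp _ _ _ _ _ G)).
Proof.
move=> U [p Up] oU.
have [psi [pp pU]] := (nbhs_typeP _ _).1 (open_nbhs_nbhs (conj oU Up)).
have [x xp] := type_realize1 pp.
by exists (tp x); split; [exact: pU|exists x].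
Qed.

(** If no formula separates, the formulas containing [C] together with those containing [D] generate
    a proper filter, and a cluster point of it lies in both sets. *)
Lemma type_separate (C D : set (type_space phi)) :
  closed C -> closed D -> C `&` D = set0 ->
  exists psi, C `<=` type_basic psi /\ D `<=` ~` type_basic psi.
Proof.
move=> cC cD CD.
pose F := filter_from [set pc : formula L M n * formula L M n |
    C `<=` type_basic pc.1 /\ D `<=` type_basic pc.2]
  (fun pc => type_basic pc.1 `&` type_basic pc.2 : set (type_space phi)).
have FF : Filter F.
  apply: filter_from_filter.
    by exists (phi, phi); split=> p _; exact: (svalP p).2.
  move=> [a b] [c d] [/= Ca Db] [/= Cc Dd]; exists (FAnd a c, FAnd b d).
    split=> p Hp; apply/type_and; split.
    - exact: Ca.
    - exact: Cc.
    - exact: Db.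
    - exact: Dd.
  by move=> p [/= /type_and[? ?] /type_and[? ?]].
have [[[a b] /= [Ca Db] ab]|nF] := pselect (F set0).
  by exists a; split=> // p /Db pb pa; have := ab p; apply.
have PF : ProperFilter F by split.
have [|p [_ pF]] := type_space_compact PF; first exact: filterE.
have Fp psi : F (type_basic psi) -> sval p psi.
  by move=> Fpsi; apply: (type_basic_closed (psi := psi)) => V /(pF _ _ Fpsi).
exfalso; suff : (C `&` D) p by rewrite CD.
split; apply: contrapT => /closed_typeP.
  move=> /(_ cC)[psi [Cpsi]]; apply; apply: Fp; exists (psi, phi) => /=.
    by split=> // q _; exact: (svalP q).2.
  by move=> q [].
move=> /(_ cD)[psi [Dpsi]]; apply; apply: Fp; exists (phi, psi) => /=.
  by split=> // q _; exact: (svalP q).2.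
by move=> q [].
Qed.

Lemma definable_map_continuous (X : topologicalType) (h : type_space phi -> X) :
  continuous h -> definable_map (fun g : G => h (tp g)).
Proof.
move=> /continuous_closedP hc C D cC cD CD.
have [|psi [Cp Dp]] := type_separate (hc _ cC) (hc _ cD).
  by rewrite -preimage_setI CD preimage_set0.
exists [set g | sat id psi (gemb g)]; split; first by exists psi.
- by move=> g /Cp.
- by move=> g /Dp.
Qed.

(** [k p] is a point common to the closures of the images of all formulas in [p]. It need not be
    shown unique: a formula of [p] that keeps [h] inside a neighbourhood of [k p] does so for every
    type containing it. *)
Lemma definable_map_extends (X : topologicalType) (h : G -> X) :
  compact [set: X] -> hausdorff_space X -> definable_map h ->
  exists2 k : type_space phi -> X, continuous k & forall g, k (tp g) = h g.
Proof.
move=> Xc XT2 hd.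
pose E p (x : X) := forall psi, sval p psi -> closure (h @` [set g | sat id psi (gemb g)]) x.
have Eex p : exists x : X, E p x.
  pose F := filter_from [set psi | sval p psi] (fun psi => h @` [set g | sat id psi (gemb g)]).
  have FF : ProperFilter F.
    apply: filter_from_proper; last first.
      by move=> psi /= /type_realize1[x xp]; exists (h x), x.
    apply: filter_from_filter; first by exists phi; exact: (svalP p).2.
    move=> a b /= pa pb; exists (FAnd a b); first by apply/type_and.
    by move=> _ [g [ga gb] <-]; split; exists g.
  have [|x [_ xF]] := Xc F; first exact: filterE.
  by exists x => psi pp W xW; apply: xF => //; exists psi.
(* For disjoint closed C and D, a formula separating their preimages or its
   negation belongs to p. *)
have Esep p (x : X) (C D : set X) : closed C -> closed D -> C `&` D = set0 -> E p x ->
    nbhs x C -> exists psi, sval p psi /\ forall g, sat id psi (gemb g) -> ~ D (h g).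
  move=> cC cD CD px xC.
  have [Z [[psi ->] CZ DZ]] := hd _ _ cC cD CD.
  exists psi; split; last by move=> g gp /DZ.
  apply: contrapT => /type_not np.
  by have [_ [[g gn <-] /CZ]] := px _ np C xC.
have [k kP] := choice Eex.
exists k; last first.
  move=> g; apply: contrapT => kg.
  have nk : nbhs (k (tp g)) (~` [set h g]).
    apply: open_nbhs_nbhs; split=> //; apply: closed_openC.
    exact: compact_closed_set1.
  have [W [oW Wk Wg]] := compact_regular_open XT2 Xc nk.
  have [|||||psi [gp]] := @Esep (tp g) (k (tp g)) (closure W) [set h g].
  - exact: closed_closure.
  - exact: compact_closed_set1.
  - by apply/seteqP; split=> // y [/Wg].
  - exact: kP.
  - by apply: filterS (open_nbhs_nbhs (conj oW Wk)); exact: subset_closure.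
  - by move=> /(_ _ gp)/=.
move=> p U kU.
have [W [oW Wk WU]] := compact_regular_open XT2 Xc kU.
have [W' [oW' Wk' WU']] := compact_regular_open XT2 Xc (open_nbhs_nbhs (conj oW Wk)).
have [|||||psi [pp ppD]] := @Esep p (k p) (closure W') (~` W).
- exact: closed_closure.
- exact: open_closedC.
- by apply/seteqP; split=> // y [/WU'].
- exact: kP.
- by apply: filterS (open_nbhs_nbhs (conj oW' Wk')); exact: subset_closure.
- apply/nbhs_typeP; exists psi; split=> // q qp /=; apply: WU.
  apply: closureS (kP _ _ qp) => _ [g gp <-].
  by apply: contrapT; exact: ppD.
Qed.

End TypeSpace.

(** * The universal definable wap ambit *)

Section TypeAction.
Variables (L : language) (M : structure L) (n : nat).
Variables (phi : formula L M n) (mu : formula L M (n + (n + n))).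
Variable G : definable_group id phi mu.
Implicit Types (p q : type_space phi) (psi : formula L M n).

Lemma type_act1 p : type_act (1%g : G) p = p.
Proof.
apply: type_ext => psi /=; split; apply: (type_mono (G := G)) => x.
  by move/sat_ltranslate; rewrite mul1g.
by move=> xp; apply/sat_ltranslate; rewrite mul1g.
Qed.

Lemma type_actM (g h : G) p : type_act (g * h)%g p = type_act g (type_act h p).
Proof.
apply: type_ext => psi /=; split; apply: (type_mono (G := G)) => x.
  by move=> /sat_ltranslate gx; apply/sat_ltranslate/sat_ltranslate; rewrite mulgA.
by move=> /sat_ltranslate/sat_ltranslate gx; apply/sat_ltranslate; rewrite -mulgA.
Qed.

Lemma type_right_translate (a : G) : exists2 r : type_space phi -> type_space phi,
  continuous r & forall g, r (tp g) = tp (g * a)%g.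
Proof.
apply: (definable_map_extends (G := G) (h := fun g => tp (g * a)%g)).
- exact: type_space_compact G.
- exact: type_space_hausdorff G.
move=> C D cC cD CD; have [psi [Cp Dp]] := type_separate G cC cD CD.
have E (g : G) := sat_rshift_point g psi (erefl (gemb (a^-1)%g) :
  gemb (a^-1)%g = id \o gemb (a^-1)%g).
eexists; split; first by eexists; reflexivity.
- by move=> g /Cp gp /=; apply/E.
- by move=> g /Dp gp /= /E.
Qed.

Lemma extension_equivariant (Y : topologicalType) (act : G -> Y -> Y) (y : Y)
    (k : type_space phi -> Y) :
  is_flow act -> continuous k -> (forall g, k (tp g) = act g y) ->
  forall g p, k (type_act g p) = act g (k p).
Proof.
move=> [_ _ YT2 [_ actM actc]] kc kE g p.
have := @dense_eq _ _ _ (k \o type_act g) (act g \o k) (dense_tp G) YT2.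
move=> /(_ _ _ _)/(congr1 (fun f => f p)); apply.
- by move=> q; apply: continuous_comp; [exact: type_act_continuous|exact: kc].
- by move=> q; apply: continuous_comp; [exact: kc|exact: actc].
- by move=> _ [h _ <-] /=; rewrite type_act_tp !kE actM.
Qed.

End TypeAction.

Section StableSpace.
Local Open Scope ring_scope.
Local Open Scope quotient_scope.
Variables (R : realType) (L : language) (M : structure L) (n : nat).
Variables (phi : formula L M n) (mu : formula L M (n + (n + n))).
Variable G : definable_group id phi mu.

Let X := stable_space R G.
Let S : topologicalType := type_space phi.
Let cls : S -> X := @stable_class R _ _ _ _ _ G.

Let cls_surj (s : X) : exists p, cls p = s.
Proof.
exists (repr (s : {eq_quot stable_equiv_rel R G})).
exact: (reprK (s : {eq_quot stable_equiv_rel R G})).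
Qed.

Let cls_continuous : continuous cls.
Proof. exact: pi_continuous. Qed.

Let cls_eq p q : cls p = cls q <-> forall F : S -> R, stable_algebra G F -> F p = F q.
Proof.
split=> [/eqmodP/asboolP//|pq].
by apply/eqmodP/asboolP.
Qed.

Let factor (Y : topologicalType) (k : S -> Y) : continuous k ->
  (forall p q, cls p = cls q -> k p = k q) ->
  exists2 f : X -> Y, continuous f & forall p, f (cls p) = k p.
Proof.
move=> kc kP; pose f (s : X) := k (sval (cid (cls_surj s))).
have fE p : f (cls p) = k p by rewrite /f; case: cid => q /= /kP.
exists f => //; apply/quotient_continuous.
have -> : f \o \pi = k; last exact: kc.
by apply/funext => p; exact: fE.
Qed.

Let algebra_lift (F : S -> R) : stable_algebra G F ->
  exists2 f : X -> R, continuous f & forall p, f (cls p) = F p.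
Proof. by move=> AF; apply: factor (proj1 AF) _ => p q /cls_eq; apply. Qed.

Let stable_act_cls (g : G) p : stable_act R G g (cls p) = cls (type_act g p).
Proof. exact: stable_act_class. Qed.

Lemma stable_space_compact : compact [set: X].
Proof.
have -> : [set: X] = range cls.
  by apply/seteqP; split=> // s _; have [p <-] := cls_surj s; exists p.
apply: continuous_compact; last exact: type_space_compact G.
exact: continuous_subspaceT.
Qed.

Lemma stable_space_hausdorff : hausdorff_space X.
Proof.
move=> s t st; have [p ps] := cls_surj s; have [q qt] := cls_surj t.
rewrite -ps -qt; apply/cls_eq => F AF; have [f fc fE] := algebra_lift AF.
rewrite -!fE ps qt; apply: (@Rhausdorff R) => U V fU fV.
have [u [Uu Vu]] := st _ _ (fc s _ fU) (fc t _ fV).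
by exists (f u).
Qed.

Lemma stable_space_flow : is_flow (stable_act R G).
Proof.
split.
- by exists (stable_base R G).
- exact: stable_space_compact.
- exact: stable_space_hausdorff.
split.
- by move=> s; have [p <-] := cls_surj s; rewrite stable_act_cls type_act1.
- move=> g h s; have [p <-] := cls_surj s.
  by rewrite !stable_act_cls type_actM.
- move=> g; apply/quotient_continuous.
  have -> : stable_act R G g \o \pi = cls \o type_act g.
    by apply/funext => p; exact: stable_act_cls.
  move=> p; apply: continuous_comp; first exact: type_act_continuous.
  exact: cls_continuous.
Qed.

Let dense_cls : dense (range (fun g : G => cls (tp g))).
Proof.
move=> U [s Us] oU; have [p ps] := cls_surj s.
have [||z [Ug [g _ gE]]] := dense_tp G (O := cls @^-1` U).
- by exists p; rewrite /= ps.
- by apply: open_comp => // q _; exact: cls_continuous.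
- by exists (cls (tp g)); split; [rewrite gE|exists g].
Qed.

Let orbit_base g : stable_act R G g (stable_base R G) = cls (tp g).
Proof. by rewrite stable_act_cls type_act_tp mulg1. Qed.

Lemma stable_space_ambit : is_ambit (stable_act R G) (stable_base R G).
Proof.
split; first exact: stable_space_flow.
rewrite /orbit; have -> : (stable_act R G)^~ (stable_base R G) =
    (fun g => cls (tp g)) by apply/funext => g; exact: orbit_base.
exact: dense_cls.
Qed.

(* The iterated limits of cls (b_j a_i) in the two orders are not separated by
   the stable formulas, hence coincide. *)
Lemma stable_continuous (f : X -> R) : continuous f -> stable_algebra G (f \o cls).
Proof.
move=> fc; split.
  by move=> p; apply: continuous_comp; [exact: cls_continuous|exact: fc].
move=> eps e0 [a [b ab]].
have [U [UU FU]] := ultraFilterLemma eventually_filter.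
have PU : ProperFilter U by exact: ultra_proper.
have UF : Filter U by exact: filter_filter.
have lim (u : nat -> X) : exists x : X, u @ U --> x.
  by have [x _ ux] := ultra_cvg UU stable_space_compact (fun i => I : [set: X] (u i)); exists x.
have [P PP] := choice (fun i => lim (fun j => cls (tp (b j * a i)%g))).
have [Q QQ] := choice (fun i => lim (fun j => cls (tp (b i * a j)%g))).
have [p pP] := lim P; have [q qQ] := lim Q.
have itlim (k : X -> R) (e : R) : continuous k -> 0 < e ->
    \forall i \near U, \forall j \near U,
    `|(k (cls (tp (b j * a i)%g)) - k (cls (tp (b i * a j)%g))) - (k p - k q)| < e.
  move=> kc e0'; have e4 : 0 < e / 4 by rewrite divr_gt0.
  have n1 := near_cvg_dist UF (cvg_comp _ _ pP (kc p)) e4.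
  have n2 := near_cvg_dist UF (cvg_comp _ _ qQ (kc q)) e4.
  apply: filterS2 n1 n2 => i i1 i2.
  have n3 := near_cvg_dist UF (cvg_comp _ _ (PP i) (kc (P i))) e4.
  have n4 := near_cvg_dist UF (cvg_comp _ _ (QQ i) (kc (Q i))) e4.
  apply: filterS2 n3 n4 => j.
  move: i1 i2; rewrite /= !ltr_norml => /andP[? ?] /andP[? ?] /andP[? ?] /andP[? ?].
  by apply/andP; split; lra.
have pq : p = q.
  have [p' pE] := cls_surj p; have [q' qE] := cls_surj q.
  rewrite -pE -qE; apply/cls_eq => F AF; have [k kc kE] := algebra_lift AF.
  rewrite -!kE pE qE; apply: contrapT => /eqP; rewrite -subr_eq0 -normr_gt0 => d0.
  have d2 : 0 < `|k p - k q| / 2 by rewrite divr_gt0.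
  have [u uE] := pairwise_sequence_filter PU (itlim k _ kc d2).
  apply: (proj2 AF) d2 _; exists (a \o u), (b \o u) => i j ij /=.
  have := uE i j ij; rewrite !kE.
  set x := F _ - F _ => xd.
  have := ler_normB x (x - (k p - k q)); rewrite opprB addrCA subrr addr0.
  lra.
have e2 : 0 < eps / 2 by rewrite divr_gt0.
have [i iP] := filter_ex (itlim f _ fc e2).
have n5 : U [set j | (i < j)%N] by apply: FU; exists i.+1.
have [j [j1 j2]] := filter_ex (filterI iP n5).
by have := ab i j j2; move: j1; rewrite /= pq subrr subr0; lra.
Qed.

(** The converse half of the double limit criterion, over the dense set of classes of realized
    types. *)
Lemma stable_space_wap : wap R (stable_act R G).
Proof.
apply/wapP => f fc h.
apply: (approximable_continuous (J := fun g : G => cls (tp g))).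
- exact: dense_cls.
- move=> g; exact: (continuous_translate stable_space_flow fc).
- move=> eps e0 [a [b ab]]; have [_ /(_ _ e0)] := stable_continuous fc; apply.
  by exists a, b => i j ij; have := ab i j ij; rewrite !stable_act_cls !type_act_tp.
Qed.

(* For stable F, the map g |-> F(gp) is a pointwise limit of the maps
   g |-> F(ga), which extend continuously to the type space. *)
Lemma stable_formula_definable (F : S -> R) p : stable_algebra G F ->
  exists2 h : S -> R, continuous h & forall g : G, h (tp g) = F (type_act g p).
Proof.
move=> [Fc Fs].
have /choice[r rP] (a : G) : exists r : S -> S,
    continuous r /\ forall g, r (tp g) = tp (g * a)%g.
  by have [r rc rE] := type_right_translate a; exists r.
have FF : ProperFilter (filter_from (nbhs p) (preimage (@tp _ _ _ _ _ G))).
  apply: filter_from_proper; last first.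
    move=> V pV; have [||z [Vg [g _ gE]]] := dense_tp G (O := V°).
    - by exists p; exact: nbhs_singleton (nbhs_interior pV).
    - exact: open_interior.
    - by exists g; rewrite /= gE; exact: interior_subset Vg.
  apply: filter_from_filter; first by exists setT; exact: filterT.
  by move=> V W pV pW; exists (V `&` W) => //; exact: filterI.
have [U [UU FU]] := ultraFilterLemma FF.
have PU : ProperFilter U by exact: ultra_proper.
have tpU : tp a @[a --> U] --> p by move=> V pV; apply: FU; exists V.
have FK : compact (range F).
  apply: continuous_compact; last exact: type_space_compact G.
  exact: continuous_subspaceT.
have [h [hh hA]] := ultra_approximable (Phi := fun (a : G) q => F (r a q))
  (t := id) UU (fun=> FK) (fun q a => imageT F _).
exists h => [|g].
  apply: approximable_continuous hA; first exact: dense_tp G.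
    move=> a q; apply: continuous_comp; [exact: (rP a).1|exact: Fc].
  move=> eps e0 [a [b ab]]; apply: (Fs _ e0); exists b, a => i j ij.
  by have := ab i j ij; rewrite !(rP _).2 distrC.
apply: (real_cvg_unique PU (hh (tp g))).
have -> : (fun a => F (r a (tp g))) = (F \o type_act g) \o tp.
  by apply/funext => a /=; rewrite (rP a).2 type_act_tp.
have Fgc : continuous (F \o type_act g).
  by move=> q; apply: continuous_comp; [exact: type_act_continuous|exact: Fc].
exact: (cvg_comp _ _ tpU (Fgc p)).
Qed.

(** A function separating [C] from [D] pulls back to a stable formula F, and g |-> F(gp) extends
    continuously to the type space. *)
Lemma stable_space_definable : definable_flow (stable_act R G).
Proof.
move=> s C D cC cD CD; have [p ps] := cls_surj s.
have [f [fc fC fD]] := compact_separator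
  stable_space_hausdorff stable_space_compact R cC cD CD.
have [h hc hE] := stable_formula_definable p (stable_continuous fc).
have hE' g : h (tp g) = f (stable_act R G g s).
  by rewrite hE /= -ps stable_act_cls.
have [|||Z [Zd ZC ZD]] := definable_map_continuous G hc (C1 := [set 0]) (C2 := [set 1]).
- exact/accessible_closed_set1/hausdorff_accessible/Rhausdorff.
- exact/accessible_closed_set1/hausdorff_accessible/Rhausdorff.
- by apply/seteqP; split=> // x [/= -> /esym/eqP]; rewrite oner_eq0.
- exists Z; split=> // g Hg; [apply: ZC|apply: ZD] => /=; rewrite hE'.
    exact: fC.
  exact: fD.
Qed.

Theorem stable_space_universal :
  universal_definable_wap_ambit R G (stable_act R G) (stable_base R G).
Proof.
split; first split.
- exact: stable_space_ambit.
- exact: stable_space_definable.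
- exact: stable_space_wap.
move=> Y act y0 [[flowY dY] defY wapY].
have [_ Yc YT2 [act1 actM actc]] := flowY.
have [k kc kE] := definable_map_extends Yc YT2 (defY y0).
(* Continuous functions on [Y] pull back to stable formulas and separate points, so [k] identifies
   equivalent types. *)
have [f fc fE] : exists2 f : X -> Y, continuous f & forall p, f (cls p) = k p.
  apply: factor => // p q /cls_eq pq.
  apply: (continuous_separates (R := R) YT2 Yc) => u uc.
  apply: (pq (u \o k)); split.
    by move=> t; apply: continuous_comp; [exact: kc|exact: uc].
  move=> eps e0 [a [b ab]]; apply: (wap_stable flowY (x0 := y0) wapY uc e0).
  by exists a, b => i j ij; have := ab i j ij; rewrite /= !kE.
have fact g s : f (stable_act R G g s) = act g (f s).
  have [p <-] := cls_surj s; rewrite stable_act_cls !fE.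
  exact: extension_equivariant flowY kc kE g p.
exists f; split=> //.
  apply: (image_dense_surj stable_space_compact YT2 fc dY) => _ [g _ <-].
  by exists (cls (tp g)) => //; rewrite fE kE.
by rewrite fE kE act1.
Qed.

End StableSpace.

(** Both composites fix the distinguished point, hence its dense orbit, hence everything. *)
Lemma universal_ambit_unique (R : realType) (L : language) (M : structure L)
    (n : nat) (phi : formula L M n) (mu : formula L M (n + (n + n)))
    (G : definable_group id phi mu) (X Y : topologicalType)
    (actX : G -> X -> X) (x0 : X) (actY : G -> Y -> Y) (y0 : Y) :
  universal_definable_wap_ambit R G actX x0 ->
  universal_definable_wap_ambit R G actY y0 ->
  exists f : X -> Y, flow_iso actX actY f /\ f x0 = y0.
Proof.
move=> [wX uX] [wY uY].
have [f [[fc fa] _ f0]] := uX _ _ _ wY; have [g [[gc ga] _ g0]] := uY _ _ _ wX.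
have comp_id (Z Z' : topologicalType) (actZ : G -> Z -> Z) (actZ' : G -> Z' -> Z')
    (z0 : Z) (z0' : Z') (u : Z -> Z') (v : Z' -> Z) :
    definable_wap_ambit R G actZ z0 -> flow_map actZ actZ' u ->
    flow_map actZ' actZ v -> u z0 = z0' -> v z0' = z0 -> cancel u v.
  move=> [[[_ _ ZT2 _] dZ] _ _] [uc ua] [vc va] u0 v0 z.
  have := @dense_eq _ _ _ (v \o u) id dZ ZT2.
  move=> /(_ _ _ _)/(congr1 (fun f => f z)); apply.
  - by move=> t; apply: continuous_comp; [exact: uc|exact: vc].
  - by move=> t; exact: cvg_id.
  - by move=> _ [h _ <-] /=; rewrite ua va u0 v0.
exists f; split=> //; split=> //; exists g; split=> //.
- exact: comp_id wX (conj fc fa) (conj gc ga) f0 g0.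
- exact: comp_id wY (conj gc ga) (conj fc fa) g0 f0.
Qed.

(** * The connected component and the quotient by it *)

Lemma embeds_power (A B : Type) : embeds A B -> embeds (set A) (set B).
Proof.
move=> [f fi]; exists (fun X => f @` X) => X Y XY; apply/funext => x.
apply/propext; split=> xX.
  have : (f @` Y) (f x) by rewrite -XY; exists x.
  by case=> y Yy /fi <-.
have : (f @` X) (f x) by rewrite XY; exists x.
by case=> y Yy /fi <-.
Qed.

(** Naming a group element takes [n] constants; this keeps the parameter set small when one element
    per coset is named. *)
Lemma embeds_prod_ord (K A : Type) n :
  embeds nat K -> embeds K (A * 'I_n) -> embeds K A.
Proof.
move=> nK; elim: n => [|n IH] KA.
  have [f _] := embeds_trans nK KA; by case: (f 0%N) => _ [].
have [|//|/IH//] := @embeds_sum K A (A * 'I_n)%type nK.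
apply: embeds_trans KA _.
exists (fun p => if unlift ord0 p.2 is Some k then inr (p.1, k) else inl p.1).
move=> [a i] [b j] /=; case: unliftP => [k|] ->; case: unliftP => [l|] -> //.
  by case=> -> ->.
by case=> ->.
Qed.

Section Saturated.
Variables (L : language) (M : structure L) (N : elementary_extension M).
Variables (n : nat) (phi : formula L M n) (mu : formula L M (n + (n + n))).
Variable G : definable_group id phi mu.
Notation emb := (@ext_emb L M N).
Variable Gs : definable_group emb phi mu.
Variable K : Type.
Hypothesis countable_theory : countable (theory M).
Hypothesis K_large : card_lt [set: set (M + nat)] [set: K].
Hypothesis N_saturated : saturated N K.
Notation small B := (~ embeds K B).
Implicit Types (x y z : Gs) (g : G).

Lemma card_lt_small (T : Type) (A : set T) : card_lt A [set: K] <-> small A.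
Proof.
split=> [[_ nKA] KA|sA]; first by apply: nKA; apply/card_ge_setT.
split; last by move=> /card_ge_setT.
by apply/card_le_setT; case: (embeds_total A K).
Qed.

Lemma small_powerset : small (set (M + nat)).
Proof.
move=> KM; apply: (proj1 (card_lt_small _) K_large).
exact: embeds_trans KM (embeds_setT _).
Qed.

Lemma embeds_nat_power : embeds nat (set (M + nat)).
Proof.
exists (fun k => [set inr k]) => k l kl.
have : [set (inr l : M + nat)] (inr k) by rewrite -kl.
by case.
Qed.

Lemma embeds_nat_K : embeds nat K.
Proof.
apply: embeds_trans embeds_nat_power _.
have [KM|//] := embeds_total K (set (M + nat)).
by have := small_powerset KM.
Qed.

Lemma small_embeds (A B : Type) : embeds A B -> small B -> small A.
Proof. by move=> AB sB KA; apply: sB; exact: embeds_trans KA AB. Qed.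

Lemma small_M : small M.
Proof.
apply: small_embeds small_powerset; exists (fun m => [set inl m]) => k l kl.
have : [set (inl l : M + nat)] (inl k) by rewrite -kl.
by case.
Qed.

Lemma small_ord m : small 'I_m.
Proof.
apply: small_embeds small_powerset.
by apply: embeds_trans embeds_nat_power; exists val; exact: val_inj.
Qed.

Lemma small_sum (A B : Type) : small A -> small B -> small (A + B).
Proof. by move=> sA sB /(embeds_sum embeds_nat_K)[]. Qed.

Lemma card_lt_range (B T : Type) (par : B -> T) :
  small B -> card_lt (range par) [set: K].
Proof.
move=> sB; apply/card_lt_small; apply: small_embeds sB.
have pre (a : range par) : exists b, par b = val a.
  by case: (set_valP a) => b _; exists b.
have [k kE] := choice pre; exists k => a b ab; apply: val_inj.
by rewrite -(kE a) -(kE b) ab.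
Qed.

Section AddedConstants.
Variables (B : Type) (par : B -> N) (j : M -> B).
Hypothesis parj : par \o j = emb.

Lemma sat_relabel_emb m (p : formula L M m) v :
  sat par (relabel j p) v <-> sat emb p v.
Proof. by rewrite sat_relabel parj. Qed.

(** The same group over more constants, so that the formulas for shifts may use new parameters. It
    is transparent because its elements must be convertible to those of [Gs]. *)
Definition group_relabel : definable_group par (relabel j phi) (relabel j mu).
Proof.
apply: (@DefinableGroup _ _ _ _ _ _ _ Gs (@gemb _ _ _ _ _ _ _ Gs)).
- exact: gemb_inj.
- by move=> v; rewrite sat_relabel_emb; exact: gemb_dom.
- by move=> x y z; rewrite sat_relabel_emb; exact: gemb_mul.
Defined.

(** Saturation concerns constants from a subset of N, here the range of [par]. Adding
    [relabel j phi] to the type forces the realization into the group. *)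
Lemma group_saturated (Phi : set (formula L B n)) : small B ->
  (forall l, (forall psi, List.In psi l -> Phi psi) ->
    exists x, forall psi, List.In psi l -> sat par psi (gemb x)) ->
  exists x, satisfies par Phi (gemb x).
Proof.
move=> sB fin; pose A : set N := range par.
pose h (b : B) : A := SigSub (mem_set (imageT par b)).
have hE : (val : A -> N) \o h = par by [].
have [|v vP] := N_saturated (card_lt_range par sB) (Phi := relabel h @` (Phi `|` [set relabel j phi])).
- move=> Psi /finite_set_In[l lE] PsiP.
  have [l' [l'P l'E]] : exists l' : seq (formula L B n),
      (forall psi, List.In psi l' -> Phi psi) /\
      forall psi, List.In psi l -> psi = relabel h (relabel j phi) \/
        exists2 chi, List.In chi l' & psi = relabel h chi.
    have : forall psi, List.In psi l ->
        (relabel h @` (Phi `|` [set relabel j phi])) psi by move=> psi /lE/PsiP.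
    elim: l {lE} => [|psi l IH] lP; first by exists [::]; split.
    have [l' [l'P l'E]] := IH (fun p pl => lP p (or_intror pl)).
    have [chi [Pchi|->] <-] := lP psi (or_introl erefl).
      exists (chi :: l'); split=> [p [<-//|/l'P//]|p [<-|/l'E[->|[q ql ->]]]].
      - by right; exists chi => //; left.
      - by left.
      - by right; exists q => //; right.
    exists l'; split=> // p [<-|/l'E//]; by left.
  have [x xP] := fin l' l'P; exists (gemb x) => psi /lE/l'E[->|[chi /xP ? ->]].
    by rewrite sat_relabel hE sat_relabel_emb; exact: sat_phi.
  by rewrite sat_relabel hE.
have /(gemb_dom Gs)[x xv] : sat emb phi v.
  rewrite -sat_relabel_emb -hE -sat_relabel; apply: vP.
  by exists (relabel j phi) => //; right.
exists x => psi Ppsi; rewrite xv -hE -sat_relabel; apply: vP.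
by exists psi => //; left.
Qed.

Lemma type_definable_small (X : set Gs) :
  small B -> type_definable_over par X -> type_definable Gs K X.
Proof.
move=> sB [Phi ->]; pose A : set N := range par.
pose h (b : B) : A := SigSub (mem_set (imageT par b)).
have hE : (val : A -> N) \o h = par by [].
exists A; split; first exact: card_lt_range.
exists (relabel h @` Phi); apply/seteqP; split=> x xP.
  by move=> _ [psi Ppsi <-]; rewrite sat_relabel hE; exact: xP.
by move=> psi Ppsi; rewrite -hE -sat_relabel; apply: xP; exists psi.
Qed.

End AddedConstants.

Definition adjoin (C : Type) (f : C -> N) (b : M + C) : N :=
  match b with inl m => emb m | inr c => f c end.

Let fclosed psi : formula L M 0 :=
  exs (subst (FAnd phi psi) (fun i => TVar (lshift 0 i) : term L M (n + 0))).

Let sat_fclosed (P : structure L) (par : M -> P)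
    (H : definable_group par phi mu) psi v :
  sat par (fclosed psi) v <-> exists x : H, sat par psi (gemb x).
Proof.
have E (w : 'I_n -> P) : (fun i => teval par (tcat w v)
    (TVar (lshift 0 i) : term L M (n + 0))) = w.
  by apply/funext => i /=; rewrite /tcat (unsplitK (inl i)).
rewrite /fclosed sat_exs; split=> [[w]|[x xp]].
  by rewrite sat_subst E => -[/(gemb_dom H)[x <-] wp]; exists x.
by exists (gemb x); rewrite sat_subst E; split=> //; exact: sat_phi.
Qed.

Lemma elementary_realize psi :
  (exists x, sat emb psi (gemb x)) -> exists g, sat id psi (gemb g).
Proof.
pose v0 (i : 'I_0) : M := match notF (ltn_ord i) with end.
move=> xp; apply/(sat_fclosed G psi v0)/(ext_elem N).
exact/(sat_fclosed Gs psi).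
Qed.

Lemma gemb_gincl g : gemb (gincl Gs g) = emb \o gemb g.
Proof. by rewrite /gincl; case: cid. Qed.

Lemma sat_gincl psi g : sat emb psi (gemb (gincl Gs g)) <-> sat id psi (gemb g).
Proof. by rewrite gemb_gincl -(ext_elem N). Qed.

Lemma gincl_mul g h : gincl Gs (g * h)%g = (gincl Gs g * gincl Gs h)%g.
Proof.
apply/esym/(gemb_mul (d := Gs)); rewrite !gemb_gincl.
have -> : tcat (emb \o gemb g) (tcat (emb \o gemb h) (emb \o gemb (g * h)%g)) =
    (fun i => emb (tcat (gemb g) (tcat (gemb h) (gemb (g * h)%g)) i)).
  apply/funext => i; rewrite /tcat; case: (fintype.split i) => //= k.
  by case: (fintype.split k).
by apply/(ext_elem N mu)/(gemb_mul (d := G)).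
Qed.

Lemma gincl1 : gincl Gs (1%g : G) = 1%g.
Proof.
by apply: (mulgI (gincl Gs (1%g : G))); rewrite -gincl_mul !mulg1.
Qed.

Lemma ginclV g : gincl Gs (g^-1)%g = ((gincl Gs g)^-1)%g.
Proof.
by apply: (mulgI (gincl Gs g)); rewrite -gincl_mul !mulgV gincl1.
Qed.

Lemma gtype_subproof x :
  complete_type id [set psi | sat emb psi (gemb x)] /\ sat emb phi (gemb x).
Proof.
split; last exact: sat_phi.
split=> [Psi /finite_set_In[l lE] PsiP|psi].
  have [|g /sat_fall gl] := @elementary_realize (fall phi l).
    exists x; apply/sat_fall/List.Forall_forall => psi /lE/PsiP.
    exact.
  exists (gemb g) => psi /lE; exact: (proj1 (List.Forall_forall _ _) gl).
by have [|] := pselect (sat emb psi (gemb x)); [left|right].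
Qed.

Definition gtype x : type_space phi := exist _ _ (gtype_subproof x).

Lemma gtype_gincl g : gtype (gincl Gs g) = tp g.
Proof. by apply: type_ext => psi; exact: sat_gincl. Qed.

Lemma gtype_surj p : exists x, gtype x = p.
Proof.
have [||x xp] := @group_saturated M emb id erefl (sval p).
- exact: small_M.
- move=> l lp; have [g gl] : exists g, sat id (fall phi l) (gemb g).
    apply: (@type_realize1 _ _ _ _ _ G p).
    elim: l lp => [|psi l IH] lp; first exact: (svalP p).2.
    apply/(type_and G); split; first exact: lp (or_introl erefl).
    by apply: IH => q ql; apply: lp; right.
  exists (gincl Gs g) => psi pl; apply/sat_gincl.
  by move/sat_fall/List.Forall_forall: gl; exact.
exists x; apply: type_ext => psi; split=> [xpsi|/xp//].
by apply: contrapT => /(type_not G)/xp /= .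
Qed.

Lemma type_definable_closed (X : set Gs) : type_definable_over emb X <->
  exists2 C, closed C & X = gtype @^-1` C.
Proof.
split=> [[Phi ->]|[C cC ->]].
  exists (\bigcap_(psi in Phi) type_basic psi).
    by apply: closed_bigI => psi _; exact: type_basic_closed G _.
  by apply/seteqP; split.
exists [set psi | C `<=` type_basic psi]; apply/seteqP; split=> x /=.
  by move=> Cx psi /(_ _ Cx).
move=> xP; apply: contrapT => /(closed_typeP G cC)[psi [Cp np]].
exact: np (xP _ Cp).
Qed.

Lemma type_definable_emb (X : set Gs) :
  type_definable_over emb X -> type_definable Gs K X.
Proof. exact: type_definable_small small_M. Qed.

(** If [x] satisfies all formulas over M implied by [X], then its type is finitely satisfiable in
    [X]: a formula of the type that misses [X] would have its negation implied by [X]. A realization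
    lies in [X], and invariance transfers this to [x]. *)
Lemma type_definable_invariant (X : set Gs) : type_definable Gs K X ->
  (forall x y, gtype x = gtype y -> X x -> X y) -> type_definable_over emb X.
Proof.
move=> [A [/card_lt_small sA [Phi XE]]] Xinv.
exists [set psi | X `<=` [set x | sat emb psi (gemb x)]].
apply/seteqP; split=> [x Xx psi /(_ _ Xx)//|x xP].
pose par := adjoin (val : A -> N).
pose Psi : set (formula L (M + A) n) :=
  (relabel inr @` Phi) `|` (relabel inl @` sval (gtype x)).
have satr (psi : formula L A n) v : sat par (relabel inr psi) v <-> sat val psi v.
  exact: sat_relabel.
have satl psi v : sat par (relabel inl psi) v <-> sat emb psi v.
  exact: (sat_relabel_emb (par := par) (j := inl)).
have [||y yP] := @group_saturated _ par inl erefl Psi.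
- exact: small_sum small_M sA.
- move=> l lP; have [psi [xpsi psiP]] : exists psi, sat emb psi (gemb x) /\
      forall y, X y -> sat emb psi (gemb y) ->
        forall chi, List.In chi l -> sat par chi (gemb y).
    elim: l lP => [|chi l IH] lP; first by exists phi; split=> //; exact: sat_phi.
    have [psi [xpsi psiP]] := IH (fun p pl => lP p (or_intror pl)).
    have [[c Pc cE]|[c Pc cE]] := lP chi (or_introl erefl); subst chi.
      exists psi; split=> // y Xy yp _ [<-|/(psiP y Xy yp)//].
      by apply/satr; rewrite XE in Xy; exact: Xy.
    exists (FAnd c psi); split=> // y Xy [yc yp] _ [<-|/(psiP y Xy yp)//].
    exact/satl.
  suff [y [Xy yp]] : exists y, X y /\ sat emb psi (gemb y).
    by exists y; exact: psiP.
  apply: contrapT => ny; have /= := xP (FNot psi); apply=> // y Xy /= yp.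
  by apply: ny; exists y.
- apply: (Xinv y x).
    apply: type_ext => psi; split=> [yp|xp].
      apply: contrapT => nx; have : Psi (relabel inl (FNot psi)).
        by right; exists (FNot psi).
      by move=> /yP/satl.
    by apply/satl/yP; right; exists psi.
  by rewrite XE => psi Ppsi; apply/satr/yP; left; exists psi.
Qed.

(* If no y in Y satisfies y u in H, then by saturation this is witnessed by
   two formulas zeta >= Y and eta >= H, and the formula (exists y, zeta(y) /\
   eta(y u)) contains the set in question but not u. *)
Lemma type_definable_prod (Y H : set Gs) :
  type_definable_over emb Y -> type_definable_over emb H ->
  type_definable_over emb [set u | exists2 y, Y y & H (y * u)%g].
Proof.
move=> [PY YE] [PH HE]; set W := [set u | _].
exists [set psi | W `<=` [set x | sat emb psi (gemb x)]].
apply/seteqP; split=> [u Wu psi /(_ _ Wu)//|u uP].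
(* The constants name u^-1, which is what the right shift by [u] uses. *)
pose par := adjoin (gemb (u^-1)%g : 'I_n -> N).
pose Gu := group_relabel (par := par) (j := inl) erefl.
pose tr (eta : formula L M n) : formula L (M + 'I_n) n :=
  finv (relabel inl phi) (relabel inl mu) (fshift (relabel inl phi) (relabel inl mu)
    (fpoint (relabel inl phi) inr) (finv (relabel inl phi) (relabel inl mu) (relabel inl eta))).
have satl psi v : sat par (relabel inl psi) v <-> sat emb psi v.
  exact: (sat_relabel_emb (par := par) (j := inl)).
have sattr eta (y : Gs) : sat par (tr eta) (gemb y) <-> sat emb eta (gemb (y * u)%g).
  have /= := @sat_rshift_point _ _ _ _ _ _ _ Gu inr (u : Gu) (y : Gu) (relabel inl eta) erefl.
  by rewrite satl.
have [||y yP] := @group_saturated _ par inl erefl (relabel inl @` PY `|` tr @` PH).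
- exact: small_sum small_M (@small_ord n).
- move=> l lP; have [zeta [eta [zP eP lE]]] : exists zeta eta,
      [/\ forall y, Y y -> sat emb zeta (gemb y),
        forall y, H y -> sat emb eta (gemb y) &
      forall y, sat emb zeta (gemb y) -> sat emb eta (gemb (y * u)%g) ->
        forall chi, List.In chi l -> sat par chi (gemb y)].
    elim: l lP => [|chi l IH] lP.
      by exists phi, phi; split=> // *; exact: sat_phi.
    have [zeta [eta [zP eP lE]]] := IH (fun p pl => lP p (or_intror pl)).
    have [[c Pc cE]|[c Pc cE]] := lP chi (or_introl erefl); subst chi.
      exists (FAnd c zeta), eta; split=> // y.
        by move=> Yy; split; [rewrite YE in Yy; exact: Yy|exact: zP].
      by move=> [yc yz] ye _ [<-|/(lE _ yz ye)//]; exact/satl.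
    exists zeta, (FAnd c eta); split=> // y.
      by move=> Hy; split; [rewrite HE in Hy; exact: Hy|exact: eP].
    by move=> yz [yc ye] _ [<-|/(lE _ yz ye)//]; exact/sattr.
  have /sat_fshift[y [yz ye]] : sat emb (fshift phi mu zeta eta) (gemb u).
    apply: uP => w [y Yy Hy]; apply/sat_fshift; exists y.
    by split; [exact: zP|exact: eP].
  by exists y; exact: lE.
exists y; first by rewrite YE => psi Ppsi; apply/satl/yP; left; exists psi.
by rewrite HE => psi Ppsi; apply/sattr/yP; right; exists psi.
Qed.

Lemma type_definable_inv (Y : set Gs) :
  type_definable_over emb Y -> type_definable_over emb [set y | Y (y^-1)%g].
Proof.
move=> [Phi ->]; exists (finv phi mu @` Phi); apply/seteqP; split=> x xP.
  by move=> _ [psi Ppsi <-]; apply/sat_finv/xP.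
by move=> psi Ppsi; apply/sat_finv/xP; exists psi.
Qed.

Lemma type_definable_formula psi :
  type_definable_over emb [set x : Gs | sat emb psi (gemb x)].
Proof.
exists [set psi]; apply/seteqP; split=> x; first by move=> ? _ ->.
by apply.
Qed.

(** * Bounded type-definable subgroups *)

Lemma type_definable_separate (X Y : set Gs) :
  type_definable_over emb X -> type_definable_over emb Y -> X `&` Y = set0 ->
  exists psi, (forall x, X x -> sat emb psi (gemb x)) /\
    (forall x, Y x -> ~ sat emb psi (gemb x)).
Proof.
move=> /type_definable_closed[C cC ->] /type_definable_closed[D cD ->] XY.
have [|psi [Cp Dp]] := type_separate G cC cD.
  apply/seteqP; split=> // p [Cp Dp]; have [x xp] := gtype_surj p; subst p.
  have : (gtype @^-1` C `&` gtype @^-1` D) x by [].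
  by rewrite XY.
by exists psi; split=> x; [exact: Cp|exact: Dp].
Qed.

(** A formula version of [H^-1 H] contained in [H]. Separation yields [psi1] around [H] with
    [psi1^-1 H] inside [chi]; then [psi2] defines the set of all y with [psi1^-1 y] inside [chi],
    which contains [H]. *)
Lemma subgroup_formula_root (H : set Gs) (chi : formula L M n) :
  subgroup H -> type_definable_over emb H ->
  (forall x, H x -> sat emb chi (gemb x)) ->
  exists psi, (forall x, H x -> sat emb psi (gemb x)) /\
    forall x y, sat emb psi (gemb x) -> sat emb psi (gemb y) ->
      sat emb chi (gemb (x^-1 * y)%g).
Proof.
move=> [H1 HM HV] Htd Hchi.
pose D := [set x : Gs | ~ sat emb chi (gemb x)].
have Dtd : type_definable_over emb [set x | D (x^-1)%g].
  exact: type_definable_inv (type_definable_formula (FNot chi)).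
have [|psi1 [Hpsi1 Wpsi1]] :=
    type_definable_separate Htd (type_definable_prod Htd Dtd).
  apply/seteqP; split=> // x [Hx [y Hy]] /=; apply.
  by apply: Hchi; rewrite invgM; apply: HM; apply: HV.
have psi1P x h : sat emb psi1 (gemb x) -> H h -> sat emb chi (gemb (x^-1 * h)%g).
  move=> xpsi Hh; apply: contrapT => nchi; apply: (Wpsi1 x) xpsi.
  by exists (h^-1)%g; [exact: HV|rewrite /D /= invgM invgK].
pose psi2 := FNot (fshift phi mu (finv phi mu psi1) (FNot chi)).
have psi2P y : sat emb psi2 (gemb y) <->
    forall x, sat emb psi1 (gemb x) -> sat emb chi (gemb (x^-1 * y)%g).
  rewrite /psi2 /= (sat_fshift (G := Gs)); split=> [nx x xpsi|xP [z [/sat_finv zpsi]]].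
    apply: contrapT => nchi; apply: nx; exists (x^-1)%g; split=> //.
    by apply/sat_finv; rewrite invgK.
  by apply; have := xP _ zpsi; rewrite invgK.
exists (FAnd psi1 psi2); split=> [x Hx|x y [xpsi _] [_ /psi2P]]; last exact.
by split; [exact: Hpsi1|apply/psi2P => z zpsi; exact: psi1P].
Qed.

(* The conditions that x is not in r psi, r ranging over representatives of the
   cosets of H, are jointly unsatisfiable, so G is covered by finitely many
   translates of psi. *)
Lemma bounded_index_cover (H : set Gs) (psi : formula L M n) :
  subgroup H -> bounded_index K H ->
  (forall x, H x -> sat emb psi (gemb x)) ->
  exists l : seq Gs, forall x, exists r,
    List.In r l /\ sat emb psi (gemb (r^-1 * x)%g).
Proof.
move=> [H1 HM HV] /card_lt_small Hb Hpsi.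
pose C : Type := range (lcoset H).
have rep (c : C) : exists r, lcoset H r = val c.
  by case: (set_valP c) => r _; exists r.
have [rp rpE] := choice rep.
pose f (p : C * 'I_n) := gemb (rp p.1)^-1%g p.2.
pose par := adjoin f.
pose Gc := group_relabel (par := par) (j := inl) erefl.
pose tr (c : C) : formula L (M + C * 'I_n) n :=
  fshift (relabel inl phi) (relabel inl mu)
    (fpoint (relabel inl phi) (fun i => inr (c, i))) (relabel inl psi).
have trE c x : sat par (tr c) (gemb x) <-> sat emb psi (gemb ((rp c)^-1 * x)%g).
  have /= := @sat_fshift_point _ _ _ _ _ _ _ Gc (fun i => inr (c, i))
    ((rp c)^-1%g : Gs) (x : Gc) (relabel inl psi) erefl.
  by rewrite (sat_relabel_emb (par := par) (j := inl)).
have small_par : small (M + C * 'I_n).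
  by apply: small_sum small_M _ => /(embeds_prod_ord embeds_nat_K).
apply: contrapT => nl.
have [l lP|x xP] := group_saturated (j := inl) (par := par) erefl (Phi := [set FNot (tr c) | c in setT]) small_par.
  have [l' l'E] : exists l' : seq C, l = [seq FNot (tr c) | c <- l'].
    elim: l lP => [|p l IH] lP; first by exists [::].
    have [l' ->] := IH (fun p pl => lP p (or_intror pl)).
    by have [c _ <-] := lP p (or_introl erefl); exists (c :: l').
  apply: contrapT => nx; apply: nl; exists [seq rp c | c <- l'] => x.
  apply: contrapT => nr; apply: nx; exists x => p; rewrite l'E.
  move=> /List.in_map_iff[c [<- cl]] /trE cx; apply: nr; exists (rp c).
  by split=> //; apply/List.in_map_iff; exists c.
have cP : range (lcoset H) (lcoset H x) by exists x.
pose c : C := SigSub (mem_set cP).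
have : sat par (FNot (tr c)) (gemb x) by apply: xP; exists c.
apply; apply/trE; apply: Hpsi.
have : lcoset H (rp c) x by rewrite rpE; exists 1%g; rewrite ?mulg1.
by case=> h Hh <-; rewrite mulgA mulVg mul1g.
Qed.

(** Given [chi] around [H], finitely many translates of a second root [psi] cover G, but by elements
    outside G(M). Replacing each by a point of G(M) in its translate costs one root: translates of
    [psi'] by G(M) cover G(M), hence G by elementarity. Being over M, such a translate contains [x]
    and [y] together, so x^-1 y satisfies [chi]. *)
Lemma bounded_gtype (H : set Gs) x y :
  bounded_type_definable_subgroup K H -> gtype x = gtype y -> H (x^-1 * y)%g.
Proof.
move=> [Hsub Htd Hb] xy; have [Phi HE] := Htd; rewrite HE => chi Pchi.
have [|psi' [Hpsi' psi'P]] := subgroup_formula_root (chi := chi) Hsub Htd.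
  by move=> z; rewrite HE; apply.
have [psi [Hpsi psiP]] := subgroup_formula_root Hsub Htd Hpsi'.
have [l lP] := bounded_index_cover Hsub Hb Hpsi.
have [lg lgP] : exists lg : seq G, forall g, exists h, List.In h lg /\
    sat emb psi' (gemb ((gincl Gs h)^-1 * gincl Gs g)%g).
  have [lg lgP] : exists lg : seq G, forall g r, List.In r l ->
      sat emb psi (gemb (r^-1 * gincl Gs g)%g) -> exists h, List.In h lg /\
      sat emb psi (gemb (r^-1 * gincl Gs h)%g).
    elim: l {lP} => [|r l [lg lgP]]; first by exists [::].
    have [[h hr]|nh] := pselect (exists h : G, sat emb psi (gemb (r^-1 * gincl Gs h)%g)).
      exists (h :: lg) => g s [<- _|sl sg]; first by exists h; split=> //; left.
      by have [k [kl ks]] := lgP g s sl sg; exists k; split=> //; right.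
    exists lg => g s [<- sg|]; first by exfalso; apply: nh; exists g.
    exact: lgP.
  exists lg => g; have [r [rl rg]] := lP (gincl Gs g).
  have [h [hl hr]] := lgP g r rl rg; exists h; split=> //.
  have := psiP _ _ hr rg; rewrite invgM invgK -mulgA.
  by rewrite (mulgA r) mulgV mul1g.
pose ps (h : G) := fshift phi mu (fpoint phi (gemb (h^-1)%g)) psi'.
have psE h z : sat emb (ps h) (gemb z) <-> sat emb psi' (gemb ((gincl Gs h)^-1 * z)%g).
  rewrite -ginclV; apply: (sat_fshift_point (G := Gs)).
  by rewrite gemb_gincl.
have [h hx] : exists h, sat emb (ps h) (gemb x).
  apply: contrapT => nh.
  have [|g /sat_fall/List.Forall_forall gP] :=
      elementary_realize (psi := fall phi [seq FNot (ps h) | h <- lg]).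
    exists x; apply/sat_fall/List.Forall_forall => p.
    by move=> /List.in_map_iff[h [<- _]] hx; apply: nh; exists h.
  have [h [hl /psE/sat_gincl hg]] := lgP g.
  have /gP : List.In (FNot (ps h)) [seq FNot (ps h) | h <- lg].
    by apply/List.in_map_iff; exists h.
  exact.
have hy : sat emb (ps h) (gemb y).
  by have : sval (gtype y) (ps h) by rewrite -xy.
have := psi'P _ _ ((psE _ _).1 hx) ((psE _ _).1 hy).
by rewrite invgM invgK -mulgA (mulgA (gincl Gs h)) mulgV mul1g.
Qed.

(** Types of coset representatives embed the cosets into sets of formulas; countability of the
    theory and the size of K bound the number of these. *)
Lemma gtype_bounded (H : set Gs) : subgroup H ->
  (forall x y, gtype x = gtype y -> H (x^-1 * y)%g) -> bounded_index K H.
Proof.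
move=> [H1 HM HV] HE; apply/card_lt_small; apply: small_embeds small_powerset.
apply: embeds_trans (embeds_power (embeds_formula_theory countable_theory n)).
have rep (c : range (lcoset H)) : exists r, lcoset H r = val c.
  by case: (set_valP c) => r _; exists r.
have [rp rpE] := choice rep.
exists (fun c => sval (gtype (rp c))) => c d cd; apply: val_inj.
have /HE Hcd : gtype (rp c) = gtype (rp d) by apply: type_ext => psi; rewrite cd.
rewrite -!rpE; apply/seteqP; split=> _ [h Hh <-].
  exists (((rp c)^-1 * rp d)^-1 * h)%g.
    by apply: HM => //; exact: HV.
  by rewrite invgM invgK !mulgA mulgV mul1g.
exists ((rp c)^-1 * rp d * h)%g; first exact: HM.
by rewrite !mulgA mulgV mul1g.
Qed.

Local Notation H00 := (G00 Gs K).

Lemma G00_subgroup : subgroup H00.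
Proof.
split=> [H [[]]//|x y Hx Hy H HP|x Hx H HP]; have [[_ HM HV] _ _] := HP.
  by apply: HM; [exact: Hx|exact: Hy].
by apply: HV; exact: Hx.
Qed.

Lemma G00_type_definable : type_definable_over emb H00.
Proof.
exists [set psi | exists2 H : set Gs, bounded_type_definable_subgroup K H &
  H `<=` [set x | sat emb psi (gemb x)]].
apply/seteqP; split=> x xP; first by move=> psi [H /xP Hx]; exact.
move=> H HP; have [_ [Phi HE] _] := HP; rewrite HE => psi Ppsi.
by apply: xP; exists H => //; rewrite HE => z; apply.
Qed.

Lemma G00_gtype x y : gtype x = gtype y -> H00 (x^-1 * y)%g.
Proof. by move=> xy H HP; exact: bounded_gtype HP xy. Qed.

Lemma G00_smallest : smallest_bounded_type_definable_subgroup Gs K H00.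
Proof.
split; last by move=> H HP x; exact.
split; [exact: G00_subgroup|exact: G00_type_definable|].
exact: gtype_bounded G00_subgroup G00_gtype.
Qed.

(** * The quotient and its logic topology *)

Local Notation Q := (GmodG00 Gs K).
Local Notation cs := (coset00 Gs K).

Lemma coset00_eq x y : cs x = cs y <-> H00 (x^-1 * y)%g.
Proof.
have [H1 HM HV] := G00_subgroup; split=> [/(congr1 sval) /= xy|Hxy].
  have : lcoset H00 y y by exists 1%g; rewrite ?mulg1.
  by rewrite -xy => -[h Hh <-]; rewrite mulgA mulVg mul1g.
have E : lcoset H00 x = lcoset H00 y.
  apply/seteqP; split=> _ [h Hh <-].
    exists ((x^-1 * y)^-1 * h)%g; first by apply: HM => //; exact: HV.
    by rewrite invgM invgK !mulgA mulgV mul1g.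
  by exists (x^-1 * y * h)%g; [exact: HM|rewrite !mulgA mulgV mul1g].
rewrite /coset00; move: (ex_intro2 _ _ x I erefl : range (lcoset H00) (lcoset H00 x)).
by rewrite E => ?; congr exist; exact: Prop_irrelevance.
Qed.

Lemma coset00_surj (c : Q) : exists x, cs x = c.
Proof.
case: c => C CP; have [x _ xC] := CP; exists x.
by rewrite /coset00; subst C; congr exist; exact: Prop_irrelevance.
Qed.

Lemma coset00_gtype x y : gtype x = gtype y -> cs x = cs y.
Proof. by move=> /G00_gtype/coset00_eq. Qed.

Definition type_coset (p : type_space phi) : Q := cs (sval (cid (gtype_surj p))).

Lemma type_coset_gtype x : type_coset (gtype x) = cs x.
Proof. by rewrite /type_coset; case: cid => y /= /coset00_gtype. Qed.

Lemma type_coset_surj (c : Q) : exists p, type_coset p = c.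
Proof.
by have [x <-] := coset00_surj c; exists (gtype x); exact: type_coset_gtype.
Qed.

(** A union of cosets of G00 depends only on types over M, so other parameters can be eliminated. *)
Lemma type_definable_coset (C : set Q) : type_definable Gs K (cs @^-1` C) ->
  type_definable_over emb (cs @^-1` C).
Proof.
move=> Ctd; apply: type_definable_invariant Ctd _ => x y /coset00_gtype xy.
by rewrite /= xy.
Qed.

Lemma type_coset_closed (C : set Q) :
  closed (type_coset @^-1` C) <-> type_definable_over emb (cs @^-1` C).
Proof.
have E D : cs @^-1` C = gtype @^-1` D <-> D = type_coset @^-1` C.
  split=> [CD|->]; last by apply/funext => x /=; rewrite type_coset_gtype.
  apply/funext => p; have [x <-] := gtype_surj p.
  by rewrite /= type_coset_gtype -[D _]/((gtype @^-1` D) x) -CD.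
rewrite type_definable_closed; split=> [cC|[D cD /E <-]//].
by exists (type_coset @^-1` C) => //; exact/E.
Qed.

Lemma type_coset_continuous : continuous type_coset.
Proof.
apply/continuousP => _ [D DfI <-]; rewrite preimage_bigcup.
apply: bigcup_open => A /DfI [E EB <-].
rewrite preimage_bigcap bigcap_fset big_seq.
elim/big_ind: _ => [|? ? ? ?|B BE]; [exact: openT|exact: openI|].
have /set_mem/= Btd := EB _ BE.
rewrite -closedC preimage_setC; apply/type_coset_closed.
exact: type_definable_coset.
Qed.

(** The generating sets are already all the open sets: a closed set pulls back to a closed set of
    types. *)
Lemma closed_coset (C : set Q) : closed C <-> type_definable Gs K (cs @^-1` C).
Proof.
split=> [cC|Ctd].
  apply: type_definable_emb; apply/type_coset_closed.
  by have /continuous_closedP := type_coset_continuous; apply.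
rewrite -[C]setCK; apply: open_closedC.
exists [set ~` C]; last by rewrite bigcup_set1.
move=> _ ->; exists [fset ~` C]%fset.
  by move=> A /fset1P ->; rewrite inE /= setCK.
by rewrite set_fset1 bigcap_set1.
Qed.

Lemma closed_coset_emb (C : set Q) :
  closed C <-> type_definable_over emb (cs @^-1` C).
Proof.
rewrite closed_coset; split; first exact: type_definable_coset.
exact: type_definable_emb.
Qed.

(** The preimage of the image is the product of [Z] and G00, which is type-definable. *)
Lemma type_coset_image_closed (Z : set (type_space phi)) :
  closed Z -> closed (type_coset @` Z).
Proof.
move=> cZ; apply/closed_coset_emb.
have Ztd : type_definable_over emb (gtype @^-1` Z).
  by apply/type_definable_closed; exists Z.
have -> : cs @^-1` (type_coset @` Z) =
    [set u | exists2 y, (gtype @^-1` Z) (y^-1)%g & H00 (y * u)%g].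
  apply/funext => u; apply/propext; split=> [[p Zp]|[y Zy Hyu]].
    have [z zp] := gtype_surj p; rewrite -zp type_coset_gtype => /coset00_eq Hzu.
    by exists (z^-1)%g; rewrite // /= invgK zp.
  exists (gtype (y^-1)%g) => //; rewrite type_coset_gtype.
  by apply/coset00_eq; rewrite invgK.
exact: type_definable_prod (type_definable_inv Ztd) G00_type_definable.
Qed.

Lemma coset_space_compact : compact [set: Q].
Proof.
have -> : [set: Q] = range type_coset.
  by apply/seteqP; split=> // c _; have [p <-] := type_coset_surj c; exists p.
apply: continuous_compact; last exact: type_space_compact G.
exact/continuous_subspaceT/type_coset_continuous.
Qed.

(** The fibres over two points are separated by a formula. As [type_coset] is a closed map, the
    points whose whole fibre lies in the formula, or in its complement, form open sets. *)
Lemma coset_space_hausdorff : hausdorff_space Q.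
Proof.
have closed1 (c : Q) : closed [set c].
  have [p pc] := type_coset_surj c.
  have -> : [set c] = type_coset @` [set p] by rewrite image_set1 pc.
  apply: type_coset_image_closed; apply: compact_closed_set1.
  exact: type_space_hausdorff G.
have closedF (c : Q) : closed (type_coset @^-1` [set c]).
  by have /continuous_closedP := type_coset_continuous; apply; exact: closed1.
rewrite open_hausdorff => c d /eqP cd.
have [|psi [Cp Dp]] := type_separate G (closedF c) (closedF d).
  by apply/seteqP; split=> // p [/= -> /cd].
have copen (Z : set (type_space phi)) : closed Z -> open (~` (type_coset @` Z)).
  by move=> cZ; apply: closed_openC; exact: type_coset_image_closed.
have oB : open (type_basic psi : set (type_space phi)) by exact: type_basic_open.
have cB : closed (type_basic psi : set (type_space phi))  by exact: (type_basic_closed G).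
exists (~` (type_coset @` ~` type_basic psi), ~` (type_coset @` type_basic psi)).
  rewrite !inE; split=> -[p pB pE].
    by apply: pB; apply: Cp.
  by have := Dp p; apply.
split; [exact/copen/open_closedC|exact: copen|].
apply/eqP/seteqP; split=> // e [e1 e2]; have [p pe] := type_coset_surj e.
have [pB|pB] := pselect (type_basic psi p); first by apply: e2; exists p.
by apply: e1; exists p.
Qed.

(** [w] need not come from G(M): its coordinates become [n] new constants, which the logic topology
    permits. *)
Lemma type_definable_ltranslate w (C : set Q) :
  closed C -> type_definable Gs K [set x | C (cs (w * x)%g)].
Proof.
move=> /closed_coset_emb[Phi CE].
pose par := adjoin (gemb w : 'I_n -> N).
pose Gw := group_relabel (par := par) (j := inl) erefl.
apply: (type_definable_small (par := par)).
  exact: small_sum small_M (@small_ord n).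
exists [set fshift (relabel inl phi) (relabel inl mu)
  (fpoint (relabel inl phi) inr) (relabel inl psi) | psi in Phi].
have trE psi x : sat par (fshift (relabel inl phi) (relabel inl mu)
    (fpoint (relabel inl phi) inr) (relabel inl psi)) (gemb x) <->
    sat emb psi (gemb (w * x)%g).
  have /= := @sat_fshift_point _ _ _ _ _ _ _ Gw inr (w : Gw) (x : Gw)
    (relabel inl psi) erefl.
  by rewrite (sat_relabel_emb (par := par) (j := inl)).
have CE' x : C (cs x) <-> satisfies emb Phi (gemb x).
  by rewrite -[C _]/((cs @^-1` C) x) CE.
apply/seteqP; split=> x /=; first by move=> /CE' xP _ [psi Ppsi <-]; exact/trE/xP.
by move=> xP; apply/CE' => psi Ppsi; apply/trE/xP; exists psi.
Qed.

Lemma type_definable_rtranslate w (C : set Q) :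
  closed C -> type_definable Gs K [set x | C (cs (x * w)%g)].
Proof.
move=> /closed_coset_emb[Phi CE].
pose par := adjoin (gemb (w^-1)%g : 'I_n -> N).
pose Gw := group_relabel (par := par) (j := inl) erefl.
apply: (type_definable_small (par := par)).
  exact: small_sum small_M (@small_ord n).
pose tr (eta : formula L M n) : formula L (M + 'I_n) n :=
  finv (relabel inl phi) (relabel inl mu) (fshift (relabel inl phi) (relabel inl mu)
    (fpoint (relabel inl phi) inr) (finv (relabel inl phi) (relabel inl mu) (relabel inl eta))).
exists (tr @` Phi).
have trE psi x : sat par (tr psi) (gemb x) <-> sat emb psi (gemb (x * w)%g).
  have /= := @sat_rshift_point _ _ _ _ _ _ _ Gw inr (w : Gw) (x : Gw)
    (relabel inl psi) erefl.
  by rewrite (sat_relabel_emb (par := par) (j := inl)).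
have CE' x : C (cs x) <-> satisfies emb Phi (gemb x).
  by rewrite -[C _]/((cs @^-1` C) x) CE.
apply/seteqP; split=> x /=; first by move=> /CE' xP _ [psi Ppsi <-]; exact/trE/xP.
by move=> xP; apply/CE' => psi Ppsi; apply/trE/xP; exists psi.
Qed.

Definition coset_rep (c : Q) : Gs := sval (cid (coset00_surj c)).

Lemma coset_repK c : cs (coset_rep c) = c.
Proof. by rewrite /coset_rep; case: cid. Qed.

Definition lmul w (c : Q) : Q := cs (w * coset_rep c)%g.

Lemma lmulE w x : lmul w (cs x) = cs (w * x)%g.
Proof.
apply/coset00_eq; rewrite invgM -mulgA (mulgA w^-1)%g mulVg mul1g.
exact/coset00_eq/coset_repK.
Qed.

Lemma lmul_continuous w : continuous (lmul w).
Proof.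
apply/continuous_closedP => C cC; apply/closed_coset.
rewrite (_ : _ @^-1` _ = [set x | C (cs (w * x)%g)]).
  exact: type_definable_ltranslate.
by apply/funext => x /=; rewrite lmulE.
Qed.

Lemma dense_coset_gincl : dense (range (fun g : G => cs (gincl Gs g))).
Proof.
move=> U [c Uc] oU; have [p pc] := type_coset_surj c.
have [||q [Uq [g _ gq]]] := dense_tp G (O := type_coset @^-1` U).
- by exists p; rewrite /= pc.
- by apply: open_comp => // ? _; exact: type_coset_continuous.
- exists (cs (gincl Gs g)); split; last by exists g.
  by rewrite -type_coset_gtype gtype_gincl gq.
Qed.

(** For c in G(M) the conjugated formulas stay over M, and tp(xc/M) depends only on tp(x/M), which
    bounds the index. *)
Lemma bounded_conjugate g :
  bounded_type_definable_subgroup K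
    [set x | H00 ((gincl Gs g)^-1 * x * gincl Gs g)%g].
Proof.
have [H1 HM HV] := G00_subgroup; set c := gincl Gs g.
have sub : subgroup [set x | H00 (c^-1 * x * c)%g].
  split=> [|x y Hx Hy|x Hx] /=.
  - by rewrite mulg1 mulVg.
  - have := HM _ _ Hx Hy; congr H00; rewrite !mulgA; congr (_ * _ * _)%g.
    by rewrite -[(_ * c * _)%g]mulgA mulgV mulg1.
  - by have := HV _ Hx; rewrite !invgM invgK mulgA.
split=> //.
  have [Phi HE] := G00_type_definable.
  pose tr psi := fshift phi mu (fpoint phi (gemb (g^-1)%g)) (finv phi mu
    (fshift phi mu (fpoint phi (gemb (g^-1)%g)) (finv phi mu psi))).
  have gE : gemb (c^-1)%g = emb \o gemb (g^-1)%g by rewrite -ginclV gemb_gincl.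
  have trE psi x : sat emb (tr psi) (gemb x) <->
      sat emb psi (gemb (c^-1 * x * c)%g).
    by rewrite (sat_fshift_point _ _ gE) (sat_rshift_point (g := c) _ _ gE).
  exists (tr @` Phi); apply/seteqP; split=> x xP.
    by move=> _ [psi Ppsi <-]; apply/trE; rewrite /= HE in xP; exact: xP.
  by rewrite /= HE => psi Ppsi; apply/trE/xP; exists psi.
apply: gtype_bounded sub _ => x y xy.
have : gtype (x * c)%g = gtype (y * c)%g.
  have gE : gemb (c^-1)%g = emb \o gemb (g^-1)%g by rewrite -ginclV gemb_gincl.
  have E psi z := sat_rshift_point (g := c) z psi gE.
  apply: type_ext => psi /=; rewrite -!E.
  by move: (congr1 sval xy) => /(congr1 (fun p => p (finv phi mu
    (fshift phi mu (fpoint phi (gemb (g^-1)%g)) (finv phi mu psi))))) /= ->.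
by move=> /G00_gtype; rewrite /= invgM !mulgA.
Qed.

(* For y in G00 and c in G(M), c^-1 y c is in G00, that is y c G00 = c G00.
   So left translation by y is the identity on a dense set, hence on Q. *)
Lemma G00_normal y z : H00 y -> H00 (z^-1 * y * z)%g.
Proof.
move=> Hy; have yid : lmul y = id.
  apply: (dense_eq dense_coset_gincl coset_space_hausdorff).
  - exact: lmul_continuous.
  - by move=> ?; exact: cvg_id.
  - move=> _ [g _ <-]; rewrite lmulE; apply/esym/coset00_eq; rewrite mulgA.
    exact: (Hy _ (bounded_conjugate g)).
have := congr1 (fun f => f (cs z)) yid; rewrite lmulE => /esym/coset00_eq.
by rewrite mulgA.
Qed.

(** Independent of the representative by normality. Right translations commute with G(M) and carry
    the orbit of the coset of 1 to any other orbit. *)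
Definition rmul w (c : Q) : Q := cs (coset_rep c * w)%g.

Lemma rmulE w x : rmul w (cs x) = cs (x * w)%g.
Proof.
apply/coset00_eq; rewrite invgM mulgA -[(_ * x)%g]mulgA; apply: G00_normal.
exact/coset00_eq/coset_repK.
Qed.

Lemma rmul_continuous w : continuous (rmul w).
Proof.
apply/continuous_closedP => C cC; apply/closed_coset.
rewrite (_ : _ @^-1` _ = [set x | C (cs (x * w)%g)]).
  exact: type_definable_rtranslate.
by apply/funext => x /=; rewrite rmulE.
Qed.

Lemma rmulK w : cancel (rmul w) (rmul w^-1%g).
Proof.
by move=> c; have [x <-] := coset00_surj c; rewrite !rmulE -mulgA mulgV mulg1.
Qed.

Lemma act00_lmul g (c : Q) : act00 G Gs K g c = lmul (gincl Gs g) c.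
Proof.
have [x <-] := coset00_surj c; rewrite lmulE.
suff : sval (act00 G Gs K g (cs x)) = sval (cs (gincl Gs g * x)%g).
  case: (act00 G Gs K g (cs x)) (cs (gincl Gs g * x)%g) => [A AP] [B BP] /= AB; subst B.
  by congr exist; exact: Prop_irrelevance.
apply/seteqP; split=> [_ [_ [h Hh <-] <-]|_ [h Hh <-]] /=.
  by exists h => //; rewrite mulgA.
by exists (x * h)%g; [exists h|rewrite mulgA].
Qed.

Lemma coset_flow : is_flow (act00 G Gs K).
Proof.
split.
- by exists (cs 1%g).
- exact: coset_space_compact.
- exact: coset_space_hausdorff.
split.
- move=> c; have [x <-] := coset00_surj c.
  by rewrite act00_lmul lmulE gincl1 mul1g.
- move=> g h c; have [x <-] := coset00_surj c.
  by rewrite !act00_lmul !lmulE gincl_mul mulgA.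
- move=> g; rewrite (_ : act00 G Gs K g = lmul (gincl Gs g)).
    exact: lmul_continuous.
  by apply/funext => c; exact: act00_lmul.
Qed.

Lemma act00_coset g x : act00 G Gs K g (cs x) = rmul x (cs (gincl Gs g)).
Proof. by rewrite act00_lmul lmulE rmulE. Qed.

Lemma coset_minimal : minimal (act00 G Gs K).
Proof.
move=> c U [d Ud] oU; have [x <-] := coset00_surj c.
have [||e [Ue [g _ ge]]] := dense_coset_gincl (O := rmul x @^-1` U).
- exists (rmul x^-1%g d) => /=.
  by have := rmulK (x^-1)%g d; rewrite invgK => ->.
- by apply: open_comp => // ? _; exact: rmul_continuous.
- exists (rmul x e); split=> //; exists g => //.
  by rewrite act00_coset ge.
Qed.

Lemma coset_definable : definable_flow (act00 G Gs K).
Proof.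
move=> c; have [x <-] := coset00_surj c.
rewrite (_ : (act00 G Gs K)^~ (cs x) = fun g => (rmul x \o type_coset) (tp g)).
  apply: definable_map_continuous => p; apply: continuous_comp.
    exact: type_coset_continuous.
  exact: rmul_continuous.
apply/funext => g; rewrite act00_coset /= -type_coset_gtype.
by rewrite gtype_gincl.
Qed.

(* A pointwise limit of the functions f(g .) is of the form f(w .). *)
Lemma coset_wap (R : realType) : wap R (act00 G Gs K).
Proof.
apply/wapP => f fc h hA.
pose B (p : seq Q * R) := [set g : G | forall c, c \in p.1 ->
  (`|f (act00 G Gs K g c) - h c| < p.2)%R].
have FF : ProperFilter (filter_from [set p : seq Q * R | (0 < p.2)%R] B).
  apply: filter_from_proper; last first.
    by move=> [s d] /= d0; have [g gP] := hA s d d0; exists g.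
  apply: filter_from_filter; first by exists ([::], 1%R) => /=.
  move=> [s d] [s' d'] /= d0 d0'; exists (s ++ s', Num.min d d').
    by rewrite /= lt_min d0.
  move=> g gP; split=> c cs; have := gP c; rewrite mem_cat cs ?orbT lt_min;
    by move=> /(_ isT)/andP[].
have [U [UU FU]] := ultraFilterLemma FF.
have PU : ProperFilter U by exact: ultra_proper.
have [c _ cP] := ultra_cvg UU coset_space_compact
  (fun g => I : [set: Q] (cs (gincl Gs g))).
have [w wc] := coset00_surj c.
suff -> : h = f \o lmul w.
  by move=> d; apply: continuous_comp; [exact: lmul_continuous|exact: fc].
apply/funext => d; apply: (real_cvg_unique PU (f := fun g => f (act00 G Gs K g d))).
  apply/cvgrPdist_lt => e e0; have : U (B ([:: d], e)) by apply: FU; exists ([:: d], e).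
  by apply: filterS => g /(_ d (mem_head _ _)); rewrite distrC.
have [z <-] := coset00_surj d.
have -> : (fun g => f (act00 G Gs K g (cs z))) = (f \o rmul z) \o (fun g => cs (gincl Gs g)).
  by apply/funext => g /=; rewrite act00_coset.
have -> : (f \o lmul w) (cs z) = (f \o rmul z) c by rewrite /= lmulE -wc rmulE.
have fzc : continuous (f \o rmul z).
  by move=> e; apply: continuous_comp; [exact: rmul_continuous|exact: fc].
exact: (cvg_comp _ _ cP (fzc c)).
Qed.

Lemma elementary_product theta psi chi x y :
  sat emb theta (gemb x) -> sat emb psi (gemb y) -> sat emb chi (gemb (x * y)%g) ->
  exists g h : G, [/\ sat id theta (gemb g), sat id psi (gemb h) &
    sat id chi (gemb (g * h)%g)].
Proof.
move=> tx py cxy.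
have [|h [ph /sat_fshift[g [tg cg]]]] :=
    elementary_realize (psi := FAnd psi (fshift phi mu theta chi)).
  by exists y; split=> //; apply/sat_fshift; exists x.
by exists g, h.
Qed.

(** * Universality among minimal flows *)

Section Universality.
Variables (R : realType) (Y : topologicalType) (act : G -> Y -> Y).
Hypothesis flowY : minimal_definable_wap_flow R G act.

Let Yflow : is_flow act. Proof. by case: flowY. Qed.
Let Yc : compact [set: Y]. Proof. by case: Yflow. Qed.
Let YT2 : hausdorff_space Y. Proof. by case: Yflow. Qed.

Let ext_exists (y : Y) : exists k : type_space phi -> Y,
  continuous k /\ forall g, k (tp g) = act g y.
Proof.
have [_ _ defY _] := flowY.
by have [k kc kE] := definable_map_extends Yc YT2 (defY y); exists k.
Qed.

Let k (y : Y) : type_space phi -> Y := sval (cid (ext_exists y)).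
Let kc (y : Y) : continuous (k y).
Proof. by rewrite /k; case: cid => ? []. Qed.
Let kE (y : Y) g : k y (tp g) = act g y.
Proof. by rewrite /k; case: cid => ? []. Qed.

Let star x (y : Y) : Y := k y (gtype x).

Let star_gincl g (y : Y) : star (gincl Gs g) y = act g y.
Proof. by rewrite /star gtype_gincl kE. Qed.

Let star1 (y : Y) : star 1%g y = y.
Proof. by rewrite -gincl1 star_gincl; case: Yflow => _ _ _ []. Qed.

Let near_formula (f : Y -> R) (y : Y) x (e : R) : continuous f -> (0 < e)%R ->
  exists psi, sat emb psi (gemb x) /\
    forall g, sat id psi (gemb g) -> (`|f (act g y) - f (star x y)| < e)%R.
Proof.
move=> fc e0; have fkc : continuous (f \o k y).
  by move=> p; apply: continuous_comp; [exact: kc|exact: fc].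
have := near_cvg_dist (nbhs_filter (gtype x)) (fkc (gtype x)) e0.
move=> /(nbhs_typeP G)[psi [xpsi psiP]]; exists psi; split=> // g gpsi.
by rewrite -kE; exact: (psiP (tp g)).
Qed.

(* Choose a, b in G(M) with a, b and a b close to x, y and x y; by
   equicontinuity a(bz) is close to a(y*z). *)
Let starM x y (z : Y) : star (x * y)%g z = star x (star y z).
Proof.
have [_ minY _ wapY] := flowY.
apply: (continuous_separates (R := R) YT2 Yc) => f fc.
apply/eqP; rewrite -subr_eq0 -normr_le0; apply: le_addgt0 => e e0; rewrite add0r.
have e3 : (0 < e / 3)%R by rewrite divr_gt0.
have [theta [tx thetaP]] := near_formula (star y z) x fc e3.
have [chi [cxy chiP]] := near_formula z (x * y)%g fc e3.
have equi := minimal_wap_equicontinuous Yflow minY wapY (star y z) fc e3.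
have kzc : continuous (k z) by exact: kc.
have /(nbhs_typeP G)[psi [py psiP]] := kzc (gtype y) _ equi.
have [a [b [ta pb cab]]] := elementary_product tx py cxy.
have t1 := thetaP a ta; have t2 := chiP _ cab.
have /= := psiP (tp b) pb a; rewrite kE.
have [_ _ _ [_ actM _]] := Yflow; rewrite actM in t2.
have s1 := ler_distD (f (act a (act b z))) (f (star (x * y)%g z)) (f (star x (star y z))).
have s2 := ler_distD (f (act a (star y z))) (f (act a (act b z))) (f (star x (star y z))).
rewrite (distrC (f (star (x * y)%g z)) (f (act a (act b z)))) in s1.
by move=> t3; lra.
Qed.

Let kernel : set Gs := [set x | forall y : Y, star x y = y].

(** Elements of the same type act alike, so the index is bounded; each condition [k y p = y] is
    closed in [p]. *)
Let kernel_bounded : bounded_type_definable_subgroup K kernel.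
Proof.
have sub : subgroup kernel.
  split=> [y|x y Hx Hy z|x Hx z]; first exact: star1.
    by rewrite starM Hy Hx.
  by rewrite -{2}[z]star1 -(mulVg x) starM Hx.
split=> //.
  apply/type_definable_closed; exists [set p | forall y : Y, k y p = y] => //.
  rewrite (_ : [set p | _] = \bigcap_(y in setT) (k y @^-1` [set y])).
    apply: closed_bigI => y _; have /continuous_closedP := kc (y := y); apply.
    exact: compact_closed_set1.
  by apply/seteqP; split=> p pP y; [move=> _; exact: pP|exact: pP y I].
apply: gtype_bounded sub _ => x y xy z; rewrite starM.
have -> : star y z = star x z by rewrite /star xy.
by rewrite -starM mulVg star1.
Qed.

Lemma coset_flow_universal : exists f : Q -> Y,
  flow_map (act00 G Gs K) act f /\ set_surj setT setT f.
Proof.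
have [[y0 _] _ _ [_ actM actc]] := Yflow.
have [_ minY _ _] := flowY.
pose f (c : Q) := star (coset_rep c) y0.
have fE x : f (cs x) = star x y0.
  have /coset00_eq Hx := coset_repK (cs x); rewrite /f.
  move: (coset_rep (cs x)) Hx => r /(_ _ kernel_bounded) Hk.
  by rewrite -[x]mul1g -(mulgV r) -mulgA starM (Hk y0).
(* As [type_coset] is closed and onto, continuity of [k y0] on types passes to the quotient. *)
have fc : continuous f.
  apply/continuous_closedP => C cC.
  have -> : f @^-1` C = type_coset @` (k y0 @^-1` C).
    apply/seteqP; split=> [c|_ [p + <-]].
      have [x <-] := coset00_surj c; rewrite /= fE => Cx; exists (gtype x) => //.
      exact: type_coset_gtype.
    by have [x <-] := gtype_surj p; rewrite /= type_coset_gtype fE.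
  by apply: type_coset_image_closed; have /continuous_closedP := kc (y := y0); apply.
exists f; split; first split=> // g c.
  have [x <-] := coset00_surj c.
  by rewrite act00_lmul lmulE !fE starM star_gincl.
apply: (image_dense_surj coset_space_compact YT2 fc (minY y0)) => _ [g _ <-].
by exists (cs (gincl Gs g)); rewrite // fE star_gincl.
Qed.

End Universality.

Lemma coset_universal_minimal (R : realType) :
  universal_minimal_definable_wap_flow R G (act00 G Gs K).
Proof.
split; first split.
- exact: coset_flow.
- exact: coset_minimal.
- exact: coset_definable.
- exact: coset_wap.
- by move=> Y actY; exact: coset_flow_universal.
Qed.

(* An endomorphism of the flow Q is a right translation, hence injective. *)
Lemma coset_universal_unique (R : realType) (Y : topologicalType)
    (actY : G -> Y -> Y) :
  universal_minimal_definable_wap_flow R G actY ->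
  exists f : Q -> Y, flow_iso (act00 G Gs K) actY f.
Proof.
move=> [mY uY].
have [f [[fc fa] fs]] := coset_flow_universal mY.
have [h [[hc ha] _]] := uY _ _ (coset_universal_minimal R).1.
have [[_ _ YT2 _] _ _ _] := mY.
have [w wE] := coset00_surj (h (f (cs 1%g))).
have hf : h \o f = rmul w.
  apply: (dense_eq dense_coset_gincl coset_space_hausdorff).
  - by move=> c; apply: continuous_comp; [exact: fc|exact: hc].
  - exact: rmul_continuous.
  - move=> _ [g _ <-] /=; have gE : cs (gincl Gs g) = act00 G Gs K g (cs 1%g).
      by rewrite act00_lmul lmulE mulg1.
    by rewrite [in LHS]gE fa ha -wE act00_lmul lmulE rmulE.
have fi : injective f.
  by move=> c d cd; apply: (can_inj (rmulK w)); rewrite -hf /= cd.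
pose f' (y : Y) := s2val (cid2 (fs y I)).
have ff' : cancel f' f by move=> y; exact: s2valP' (cid2 (fs y I)).
have f'f : cancel f f' by move=> c; apply: fi; rewrite ff'.
exists f; split=> //; exists f'; split=> //; split.
  exact: continuous_bijection_inverse coset_space_compact YT2 fc f'f ff'.
by move=> g y; apply: fi; rewrite ff' fa ff'.
Qed.

End Saturated.

Theorem proposition4p17 (R : realType) (L : language) (M : structure L)
    (countable_theory : countable (theory M))
    (n : nat) (phi : formula L M n) (mu : formula L M (n + (n + n)))
    (G : definable_group id phi mu)
    (N : elementary_extension M) (K : Type)
    (K_large : card_lt [set: set (M + nat)] [set: K])
    (N_saturated : saturated N K)
    (Gs : definable_group (@ext_emb L M N) phi mu) :
  (universal_definable_wap_ambit R G (stable_act R G) (stable_base R G) /\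
   forall (Y : topologicalType) (actY : G -> Y -> Y) (y0 : Y),
     universal_definable_wap_ambit R G actY y0 ->
     exists f : stable_space R G -> Y,
       flow_iso (stable_act R G) actY f /\ f (stable_base R G) = y0) /\
  [/\ smallest_bounded_type_definable_subgroup Gs K (G00 Gs K),
      forall C : set (GmodG00 Gs K),
        closed C <-> type_definable Gs K (coset00 Gs K @^-1` C),
      universal_minimal_definable_wap_flow R G (act00 G Gs K) &
      forall (Y : topologicalType) (actY : G -> Y -> Y),
        universal_minimal_definable_wap_flow R G actY ->
        exists f : GmodG00 Gs K -> Y, flow_iso (act00 G Gs K) actY f].

Proof.
split.
  split; first exact: stable_space_universal.
  by move=> Y actY y0; apply: universal_ambit_unique; exact: stable_space_universal.
split.
- exact: (G00_smallest G Gs countable_theory K_large N_saturated).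
- by move=> C; exact: (closed_coset G K_large N_saturated).
- exact: (coset_universal_minimal G Gs countable_theory K_large N_saturated R).
- move=> Y actY; exact: (coset_universal_unique Gs countable_theory K_large N_saturated).
Qed.
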